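(* Let $d\in\mathbb{N}$ and let $0\le a<\frac{d+1}{2}$. Then there do not exist a constant $C>0$ and $n\in\mathbb{N}$ such that $$\|\varphi\|_{\mathrm{Mult}(\mathcal{D}_a(\mathbb{B}_d))} \le C\,\|\varphi\|_{\mathrm{Mult}(\mathcal{D}_a(\mathbb{B}_d)),n}$$ for all $\varphi\in\mathrm{Mult}(\mathcal{D}_a(\mathbb{B}_d))$.
   Context: $\mathbb{B}_d$ is the open Euclidean unit ball in $\mathbb{C}^d$. For $a\in(0,\infty)$, $\mathcal{D}_a(\mathbb{B}_d)$ is the reproducing kernel Hilbert space on $\mathbb{B}_d$ with kernel $\frac{1}{(1-\langle z,w\rangle)^a}$; $\mathcal{D}_0(\mathbb{B}_d)$ is the one with kernel $\frac{1}{\langle z,w\rangle}\log\big(\frac{1}{1-\langle z,w\rangle}\big)$ (equal to $1$ when $\langle z,w\rangle=0$). For a reproducing kernel Hilbert space $\mathcal{H}$ on a set $X$ with kernel $K$, $\mathrm{Mult}(\mathcal{H})$ is the set of functions $\varphi:X\to\mathbb{C}$ with $\varphi f\in\mathcal{H}$ for all $f\in\mathcal{H}$, and $\|\varphi\|_{\mathrm{Mult}(\mathcal{H})}$ is the operator norm of $f\mapsto\varphi f$ on $\mathcal{H}$. A function $L:X\times X\to\mathbb{C}$ is $n$-point positive if for every collection $x_1,\dots,x_n$ of $n$ (not necessarily distinct) points of $X$ the matrix $[L(x_i,x_j)]_{i,j=1}^n$ is positive semi-definite. The $n$-point multiplier norm of $\varphi:X\to\mathbb{C}$ is $$\|\varphi\|_{\mathrm{Mult}(\mathcal{H}),n}=\inf\{C\ge0: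 (z,w)\mapsto K(z,w)(C^2-\varphi(z)\overline{\varphi(w)})\text{ is }n\text{-point positive}\},$$ understood as $+\infty$ if no such $C$ exists. *)

(* Defs.v *)
From HB Require Import structures.
From mathcomp Require Import all_boot all_order all_algebra.
From mathcomp Require Import all_classical all_reals all_analysis.
From mathcomp Require Import complex.
Set Implicit Arguments.
Unset Strict Implicit.
Unset Printing Implicit Defensive.
Import Order.TTheory GRing.Theory Num.Theory.
Local Open Scope classical_set_scope.
Local Open Scope ring_scope.
Local Open Scope complex_scope.

(* The reproducing kernel Hilbert space on X with kernel K: a complex Hilbert
   space of functions on X, with inner product linear in the first argument.
   By the Moore-Aronszajn theorem K determines the carrier and the inner
   product on it; outside of the carrier, rk_inner is unspecified. *)
Record rkhs (R : realType) (X : Type) (K : X -> X -> R[i]) := Rkhs {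
  rk_carrier : set (X -> R[i]) ;
  rk_inner : (X -> R[i]) -> (X -> R[i]) -> R[i] ;
  rk_zero : rk_carrier 0 ;
  rk_linear : forall (c : R[i]) f g,
    rk_carrier f -> rk_carrier g -> rk_carrier (c *: f + g) ;
  rk_inner_linear : forall (c : R[i]) f g h,
    rk_carrier f -> rk_carrier g -> rk_carrier h ->
    rk_inner (c *: f + g) h = c * rk_inner f h + rk_inner g h ;
  rk_inner_conj : forall f g, rk_carrier f -> rk_carrier g ->
    rk_inner g f = (rk_inner f g)^* ;
  rk_inner_pos : forall f, rk_carrier f -> f <> 0 -> 0 < rk_inner f f ;
  rk_complete : forall u : nat -> X -> R[i], (forall n, rk_carrier (u n)) ->
    (forall e : R, 0 < e -> exists N : nat, forall m n : nat,
      (N <= m)%N -> (N <= n)%N ->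
      Num.sqrt (complex.Re (rk_inner (u m - u n) (u m - u n))) < e) ->
    exists2 f, rk_carrier f &
      forall e : R, 0 < e -> exists N : nat, forall n : nat, (N <= n)%N ->
      Num.sqrt (complex.Re (rk_inner (u n - f) (u n - f))) < e ;
  rk_kernel : forall w, rk_carrier (fun z => K z w) ;
  rk_reproducing : forall f w, rk_carrier f ->
    f w = rk_inner f (fun z => K z w) }.

Definition rk_norm (R : realType) (X : Type) (K : X -> X -> R[i])
    (H : rkhs K) (f : X -> R[i]) : R :=
  Num.sqrt (complex.Re (rk_inner H f f)).

Definition mult (R : realType) (X : Type) (K : X -> X -> R[i]) (H : rkhs K) :
    set (X -> R[i]) :=
  [set phi | forall f, rk_carrier H f -> rk_carrier H (phi \* f)].

Definition mult_norm (R : realType) (X : Type) (K : X -> X -> R[i])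
    (H : rkhs K) (phi : X -> R[i]) : \bar R :=
  ereal_sup [set (rk_norm H (phi \* f))%:E | f in
    [set f | rk_carrier H f /\ rk_norm H f <= 1]].

(* In R[i], 0 <= z means that z is real and nonnegative, so that a positive
   semi-definite matrix is in particular Hermitian. *)
Definition psdmx (R : realType) (n : nat) (A : 'M[R[i]]_n) : Prop :=
  forall v : 'I_n -> R[i], 0 <= \sum_i \sum_j (v i)^* * A i j * v j.

Definition npoint_positive (R : realType) (X : Type) (n : nat)
    (L : X -> X -> R[i]) : Prop :=
  forall x : 'I_n -> X, psdmx (\matrix_(i, j) L (x i) (x j)).

(* The infimum of the empty set is +oo in \bar R. *)
Definition npoint_mult_norm (R : realType) (X : Type) (K : X -> X -> R[i])
    (n : nat) (phi : X -> R[i]) : \bar R :=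
  ereal_inf [set C%:E | C in [set C : R | 0 <= C /\
    npoint_positive n
      (fun z w => K z w * ((C ^+ 2)%:C - phi z * (phi w)^*))]].

Definition cdot (R : realType) (d : nat) (z w : 'rV[R[i]]_d) : R[i] :=
  \sum_(i < d) z 0 i * (w 0 i)^*.

Definition unit_ball (R : realType) (d : nat) : Type :=
  {z : 'rV[R[i]]_d | \sum_(i < d) `|z 0 i| ^+ 2 < 1}.

(* Principal branches of the argument, with values in ]-pi, pi], of the
   logarithm and of real powers, for u != 0. *)
Definition carg (R : realType) (u : R[i]) : R :=
  let t := acos (complex.Re u / Normc.normc u) in
  if 0 <= complex.Im u then t else - t.

Definition clog (R : realType) (u : R[i]) : R[i] :=
  ln (Normc.normc u) +i* carg u.

Definition cexp (R : realType) (u : R[i]) : R[i] :=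
  (expR (complex.Re u))%:C * (cos (complex.Im u) +i* sin (complex.Im u)).

Definition cpow (R : realType) (u : R[i]) (a : R) : R[i] :=
  cexp (a%:C * clog u).

Definition Da_kernel (R : realType) (d : nat) (a : R)
    (z w : unit_ball R d) : R[i] :=
  let u := cdot (val z) (val w) in
  if a == 0 then (if u == 0 then 1 else u^-1 * clog (1 - u)^-1)
  else (cpow (1 - u) a)^-1.
Arguments Da_kernel {R} d a z w.

(* Main.v *)
Require Import Defs.
From mathcomp Require Import all_boot all_order all_algebra.
From mathcomp Require Import all_classical all_reals all_analysis.
From mathcomp Require Import complex ring lra.
From mathcomp Require cyclic separable cyclotomic.
Set Implicit Arguments.
Unset Strict Implicit.
Unset Printing Implicit Defensive.
Import Order.TTheory GRing.Theory Num.Theory.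
Import numFieldNormedType.Exports.
Local Open Scope classical_set_scope.
Local Open Scope complex_scope.
Local Open Scope ring_scope.

(** Everything happens on the powers of the single function
    r(z) = prod_i (sqrt d * z_i), [diag_monomial], which is bounded by 1 on the
    ball by the inequality between arithmetic and geometric means. Write
    omega_N for the squared norm of r^N, [diag_norm2]. Because a < (d + 1) / 2,
    the ratio omega_(N+1) / omega_N exceeds 1 by a multiple of 1 / N, so that
    omega_N tends to infinity; since 1 has norm 1, the multiplier norm of r^N
    is at least the square root of omega_N ([mult_norm_diag_ge]).

    The n-point norm of r^N is much smaller. Let mu_1, ..., mu_n be the values
    of r at n points. The polynomial
      prod_i (X^L - (1 / L) sum_(1 <= j <= L) mu_i^j X^(L - j))
    vanishes at all of them, and expanding it shows that at these points
    r^(n L) equals psi = sum_(k < n L) b_k r^k, where every b_k has modulus at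
    most 2^n / L ([interpolation_bounded]). Hence the n-point norm of r^M,
    M = n L, is at most the largest multiplier norm of such a psi. By convexity
    of the square, psi K psi^* is at most M (2^n / L)^2 times the sum over
    k < M of r^k K (r^k)^*, as kernels ([positive_convexity]).

    That sum is at most omega_M (sum_(i < M) 1 / omega_i) times K
    ([kernel_dominated], [growth_prod_sum_le]). Indeed, in the expansion of
    these kernels in monomials only the norms of r^j z^alpha against z^alpha
    matter; by the inequality of the means they grow no faster than in the
    diagonal case alpha = (q, ..., q), where the growth is that of omega, and
    the ratios omega_(i+1) / omega_i decrease.

    If the multiplier norm were at most C times the n-point norm, then
      omega_M <= C^2 M (2^n / L)^2 omega_M sum_(i < M) 1 / omega_i,
    that is 1 <= C^2 n^2 4^n (1 / M) sum_(i < M) 1 / omega_i, and the means on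
    the right tend to 0 with 1 / omega_i.

    Three facts connect this with the given space. The kernel, defined through
    principal branches, is a power series sum_k c_k <z, w>^k with c_k > 0
    ([binomial_series], [log_series]). A function phi for which A K - phi K phi^*
    is positive is a multiplier ([positive_multiplier]), by the Riesz
    representation theorem. The norm of r^N is bounded below by testing r^N on
    points of a torus with coordinates proportional to roots of unity, which
    singles out one Taylor coefficient of the kernel ([diag_monomial_norm_ge]). *)

(** * Limits of complex sequences *)

Section ComplexLimits.
Variable R : realType.
Implicit Types (u v : nat -> R[i]) (l : R[i]).

Definition ccvg (u : nat -> R[i]) (l : R[i]) :=
  (fun n => complex.Re (u n)) @ \oo --> complex.Re l /\
  (fun n => complex.Im (u n)) @ \oo --> complex.Im l.

Lemma ccvg_cst (l : R[i]) : ccvg (fun=> l) l.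
Proof. by split; exact: cvg_cst. Qed.

Lemma ccvgD u v l m : ccvg u l -> ccvg v m -> ccvg (fun n => u n + v n) (l + m).
Proof.
have reD (z w : R[i]) : complex.Re (z + w) = complex.Re z + complex.Re w by case: z; case: w.
have imD (z w : R[i]) : complex.Im (z + w) = complex.Im z + complex.Im w by case: z; case: w.
move=> [u1 u2] [v1 v2]; split.
- by rewrite reD; under eq_fun do rewrite reD; apply: cvgD.
- by rewrite imD; under eq_fun do rewrite imD; apply: cvgD.
Qed.

Lemma ccvgZ u l (z : R[i]) : ccvg u l -> ccvg (fun n => z * u n) (z * l).
Proof.
case: z => p q.
have reM (w : R[i]) : complex.Re ((p +i* q) * w) = p * complex.Re w - q * complex.Im w by case: w.
have imM (w : R[i]) : complex.Im ((p +i* q) * w) = p * complex.Im w + q * complex.Re w by case: w.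
move=> [u1 u2]; split.
- by rewrite reM; under eq_fun do rewrite reM; apply: cvgB; apply: cvgMl_tmp.
- by rewrite imM; under eq_fun do rewrite imM; apply: cvgD; apply: cvgMl_tmp.
Qed.

Lemma ccvg_sum (I : Type) (s : seq I) (P : pred I) (u : I -> nat -> R[i]) (l : I -> R[i]) :
  (forall i, ccvg (u i) (l i)) ->
  ccvg (fun n => \sum_(i <- s | P i) u i n) (\sum_(i <- s | P i) l i).
Proof.
move=> ul; elim: s => [|i s IH].
  by rewrite big_nil; under eq_fun do rewrite big_nil; exact: ccvg_cst.
rewrite big_cons; under eq_fun do rewrite big_cons.
by case: ifP => // _; exact: ccvgD.
Qed.

Lemma ccvg_unique u l m : ccvg u l -> ccvg u m -> l = m.
Proof.
move=> [u1 u2] [v1 v2]; apply/eqP; rewrite eq_complex.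
by rewrite (cvg_unique (@Rhausdorff R) u1 v1) (cvg_unique (@Rhausdorff R) u2 v2) !eqxx.
Qed.

Lemma ccvg_ge0 u l : (forall n, 0 <= u n) -> ccvg u l -> 0 <= l.
Proof.
move=> u0 [u1 u2]; rewrite lecE/=; apply/andP; split.
- have e : (fun n => complex.Im (u n)) = fun=> 0.
    by apply/funext => n; exact: ger0_Im.
  by rewrite e in u2; rewrite -(cvg_lim (@Rhausdorff R) u2) lim_cst.
- have e : cvgn (fun n => complex.Re (u n)) by apply/cvg_ex; exists (complex.Re l).
  rewrite -(cvg_lim _ u1)//; apply: limr_ge => //; near=> n.
  by have := u0 n; rewrite lecE => /andP[].
Unshelve. all: by end_near. Qed.

Lemma ccvg_shift u l m : ccvg u l -> ccvg (fun n => u (n - m)%N) l.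
Proof.
have h (s : R^nat) (a : R) : s @ \oo --> a -> (fun n => s (n - m)%N) @ \oo --> a.
  by move=> sa; rewrite -(cvg_shiftn m)/=; under eq_fun do rewrite addnK.
by move=> [u1 u2]; split; [exact: (h _ _ u1)|exact: (h _ _ u2)].
Qed.

Lemma ccvg_shiftS u l : ccvg u l -> ccvg (fun n => u n.+1) l.
Proof. by move=> [u1 u2]; split; rewrite (cvg_shiftS (fun n => _ (u n))). Qed.

Lemma ccvg_addn u l m :
  ccvg u l -> ccvg (fun n => u (m + n)%N) l.
Proof.
move=> ul; elim: m => [|m IH]; first by under eq_fun do rewrite add0n.
by have := ccvg_shiftS IH; congr ccvg; apply/funext => n; rewrite addnS.
Qed.

Lemma ccvg_unshiftS u l :
  ccvg (fun n => u n.+1) l -> ccvg u l.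
Proof.
by move=> [u1 u2]; split; [rewrite -(cvg_shiftS (fun n => complex.Re (u n)))|
  rewrite -(cvg_shiftS (fun n => complex.Im (u n)))].
Qed.

End ComplexLimits.

(** * Power series with bounded terms *)

Section PowerSeries.
Variable R : realType.
Implicit Types (f : R^nat) (r t : R).

Lemma is_derive0_cst (h : R -> R) :
  (forall t, 0 <= t <= 1 -> is_derive t 1 h 0) -> h 1 = h 0.
Proof.
move=> dh.
have [||t _] := @MVT_segment R h (fun=> 0) 0 1 ler01.
- by move=> t; rewrite in_itv/= => /andP[t0 t1]; apply: dh; rewrite !ltW.
- apply: derivable_within_continuous => t; rewrite in_itv/= => t01.
  by case: (dh _ t01).
- by rewrite mul0r => /eqP; rewrite subr_eq0 => /eqP.
Qed.

(** Bounded terms, rather than convergence at r: this is what passes to the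
    differentiated series at every smaller radius, and it implies convergence
    inside. *)
Definition geom_bounded f r := exists B, forall k, `|f k| * r ^+ k <= B.

Lemma geom_bounded_cvg f r t :
  geom_bounded f r -> `|t| < r -> cvgn (pseries f t).
Proof.
move=> [B hB] tr.
have r0 : 0 < r by apply: le_lt_trans tr.
have q1 : `| `|t| / r| < 1.
  by rewrite ger0_norm ?divr_ge0// 1?ltW// ltr_pdivrMr// mul1r.
apply: normed_cvg.
have B0 : 0 <= B.
  by apply: le_trans (hB 0%N); rewrite mulr_ge0// exprn_ge0// ltW.
apply: (@series_le_cvg R _ (geometric B (`|t| / r))) => [k|k|k|]/=.
- by [].
- by rewrite mulr_ge0// exprn_ge0// divr_ge0// ?ltW.
- rewrite normrM normrX expr_div_n [X in _ <= X]mulrCA mulrC.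
  by rewrite ler_wpM2l ?exprn_ge0// ler_pdivlMr ?exprn_gt0.
- exact: is_cvg_geometric_series.
Qed.

(** Each of the k + 1 first powers of q is at least q^k, and their sum is at
    most that of the whole geometric series. *)
Lemma natr_geom_le q k : 0 <= q -> q < 1 -> k.+1%:R * q ^+ k <= (1 - q)^-1 :> R.
Proof.
move=> q0 q1.
have : k.+1%:R * q ^+ k <= \sum_(i < k.+1) q ^+ i.
  rewrite mulr_natl -[X in _ *+ X]card_ord -sumr_const.
  by apply: ler_sum => i _; rewrite ler_wiXn2l// ?ltW// -ltnS.
move=> /le_trans; apply.
rewrite -[X in _ <= X]mul1r ler_pdivlMr ?subr_gt0//.
by rewrite mulrC -opprB mulNr -subrX1 opprB lerBlDr lerDl exprn_ge0.
Qed.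

Lemma geom_bounded_diffs f r s : 0 < s -> s < r ->
  geom_bounded f r -> geom_bounded (pseries_diffs f) s.
Proof.
move=> s0 sr [B hB]; have r0 := lt_trans s0 sr.
exists ((1 - s / r)^-1 * (B / r)) => k.
rewrite /pseries_diffs normrM ger0_norm//.
have -> : k.+1%:R * `|f k.+1| * s ^+ k =
   (k.+1%:R * (s / r) ^+ k) * ((`|f k.+1| * r ^+ k.+1) / r).
  by rewrite expr_div_n exprS; field; rewrite expf_neq0 lt0r_neq0.
apply: ler_pM.
- by rewrite mulr_ge0// exprn_ge0// divr_ge0// ?ltW.
- by rewrite !mulr_ge0// ?invr_ge0 ?exprn_ge0// ltW.
- apply: natr_geom_le; first by rewrite divr_ge0// ?ltW.
  by rewrite ltr_pdivrMr// mul1r.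
- by rewrite ler_pM2r ?invr_gt0.
Qed.

(** Termwise differentiation asks for convergence of the second derived series
    at a radius beyond |t|; the radii s 1 < s 3 < s 4 < r leave room for the
    two losses of radius. *)
Lemma geom_bounded_derive f r t : geom_bounded f r -> `|t| < r ->
  is_derive t 1 (fun x => limn (pseries f x)) (limn (pseries (pseries_diffs f) t)).
Proof.
move=> fr tr.
pose s k := `|t| + (r - `|t|) * k%:R / 5%:R : R.
have s0 k : (0 < k)%N -> 0 < s k.
  move=> k0; rewrite /s; apply: ltr_wpDl => //.
  by rewrite !mulr_gt0 ?subr_gt0 ?ltr0n.
have ss k : (s k < s k.+1).
  rewrite /s ltrD2l ltr_pM2r ?invr_gt0 ?ltr0n//.
  by rewrite ltr_pM2l ?subr_gt0// ltr_nat.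
have s5 : s 5%N = r by rewrite /s mulfK ?pnatr_eq0// addrC subrK.
have st : `|t| < s 1%N by have := ss 0%N; rewrite {1}/s mulr0 mul0r addr0.
have b4 := geom_bounded_diffs (s0 4%N isT) _ fr.
have {}b4 : geom_bounded (pseries_diffs f) (s 4%N) by apply: b4; rewrite -s5.
have b3 := geom_bounded_diffs (s0 3%N isT) (ss 3%N) b4.
have n1 : `|s 1%N| < s 3%N.
  by rewrite gtr0_norm ?s0// (lt_trans (ss _)).
have n4 : `|s 1%N| < s 4%N by rewrite (lt_trans n1).
apply: (@pseries_snd_diffs R f (s 1%N)).
- by apply: geom_bounded_cvg fr _; rewrite -s5 (lt_trans n4).
- exact: geom_bounded_cvg b4 _.
- exact: geom_bounded_cvg b3 _.
- by rewrite [X in _ < X]gtr0_norm ?s0.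
Qed.

End PowerSeries.

(** * The logarithm along a ray *)

Section Log.
Variable R : realType.
Implicit Types (f g : R -> R) (t : R).

(** On the right half plane the principal argument is the smooth function
    arctan (Im w / Re w), and the segment from 1 to 1 - u stays there when
    |u| < 1. *)
Lemma carg_atan (w : R[i]) : 0 < complex.Re w ->
  carg w = atan (complex.Im w / complex.Re w).
Proof.
case: w => p q /= p0; rewrite /carg /=.
set x := q / p.
have c0 : p / Num.sqrt (p ^+ 2 + q ^+ 2) = cos (atan x).
  rewrite cos_atan.
  have -> : p ^+ 2 + q ^+ 2 = p ^+ 2 * (1 + x ^+ 2).
    by rewrite /x expr_div_n; field; rewrite lt0r_neq0.
  rewrite sqrtrM ?sqr_ge0// sqrtr_sqr ger0_norm ?ltW//.
  rewrite invfM mulrA divff ?mul1r//; exact: lt0r_neq0.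
have pi0 := pi_gt0 R.
have [t0 t1] : - (pi / 2) < atan x /\ atan x < pi / 2.
  by split; [exact: atan_gtNpi2|exact: atan_ltpi2].
rewrite c0; case: ifPn => [q0|].
  have x0 : 0 <= atan x by rewrite -(atan0 R) le_atan// /x divr_ge0// ltW.
  apply: cosK; rewrite in_itv/= x0/=; lra.
rewrite -ltNge => q0.
have x0 : atan x <= 0.
  by rewrite -(atan0 R) le_atan// /x pmulr_lle0 ?invr_gt0// ltW.
by rewrite cosKN ?opprK// x0 andbT; lra.
Qed.

(** The derivation rules in pointwise form, so that the derivative of an
    explicit expression is assembled by applying them to one another. *)
Lemma is_derive_addE t f g a b : is_derive t 1 f a -> is_derive t 1 g b ->
  is_derive t 1 (fun s => f s + g s) (a + b).
Proof. by move=> df dg; apply: is_deriveD. Qed.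

Lemma is_derive_oppE t f a : is_derive t 1 f a ->
  is_derive t 1 (fun s => - f s) (- a).
Proof. by move=> df; apply: is_deriveN. Qed.

Lemma is_derive_mulE t f g a b : is_derive t 1 f a -> is_derive t 1 g b ->
  is_derive t 1 (fun s => f s * g s) (f t * b + g t * a).
Proof. by move=> df dg; apply: is_deriveM. Qed.

Lemma is_derive_compE t f g a b : is_derive (g t) 1 f a -> is_derive t 1 g b ->
  is_derive t 1 (fun s => f (g s)) (a * b).
Proof. by move=> df dg; apply: is_derive1_comp. Qed.

Lemma is_derive_cstE t (a : R) : is_derive t 1 (fun=> a) 0.
Proof. exact: is_derive_cst. Qed.

Variables (x y : R).
Hypothesis xy : x ^+ 2 + y ^+ 2 < 1.

Let P t := 1 - t * x.
Let Q t := - (t * y).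
Let N t := P t ^+ 2 + Q t ^+ 2.
(** [ray_ln] and [ray_arg] are the real and imaginary parts of the principal
    logarithm of 1 - t u, for u = x + i y. *)
Definition ray_ln t := ln (N t) / 2.
Definition ray_arg t := atan (Q t / P t).

Let dP t : is_derive t 1 P (- x).
Proof. by rewrite /P; apply: is_derive_eq; rewrite /GRing.scale/=; ring. Qed.

Let dQ t : is_derive t 1 Q (- y).
Proof. by rewrite /Q; apply: is_derive_eq; rewrite /GRing.scale/=; ring. Qed.

Lemma ray_re_gt0 t : 0 <= t <= 1 -> 0 < 1 - t * x.
Proof.
move=> /andP[t0 t1]; rewrite subr_gt0.
have x1 : x < 1.
  rewrite ltNge; apply/negP => x1.
  by move: (sqr_ge0 y) (@exprn_ege1 _ 2 _ x1) xy => *; lra.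
case: (leP x 0) => x0; first by apply: le_lt_trans ltr01; exact: mulr_ge0_le0.
by apply: le_lt_trans x1; rewrite ler_piMl// ltW.
Qed.

Let N_gt0 t : 0 <= t <= 1 -> 0 < N t.
Proof.
by move=> /ray_re_gt0 p0; rewrite /N ltr_pwDl ?sqr_ge0// exprn_gt0.
Qed.

Lemma ray_ln_derive t : 0 <= t <= 1 ->
  is_derive t 1 ray_ln ((- x * P t - y * Q t) / N t).
Proof.
move=> t01; have N0 := N_gt0 t01; rewrite /ray_ln.
have h := is_derive_mulE (is_derive_compE (is_derive1_ln N0)
  (is_derive_addE (is_derive_mulE (dP t) (dP t)) (is_derive_mulE (dQ t) (dQ t))))
  (is_derive_cstE t 2^-1).
by apply: is_derive_eq h _; rewrite mulr0 add0r; field; rewrite lt0r_neq0.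
Qed.

Lemma ray_arg_derive t : 0 <= t <= 1 ->
  is_derive t 1 ray_arg ((- y * P t + x * Q t) / N t).
Proof.
move=> t01; have N0 := N_gt0 t01; have p0 : 0 < P t := ray_re_gt0 t01.
rewrite /ray_arg.
have h := @is_derive_compE t (@atan R) (fun s => Q s / P s) _ _
  (is_derive1_atan (Q t / P t))
  (is_derive_mulE (dQ t) (is_deriveV (lt0r_neq0 p0) (dP t))).
apply: is_derive_eq h _.
rewrite /GRing.scale/=; move: N0; rewrite /N => N0; field.
by rewrite !lt0r_neq0.
Qed.

Lemma ray_ln0 : ray_ln 0 = 0.
Proof. by rewrite /ray_ln /N /P /Q !mul0r subr0 oppr0 expr1n expr0n addr0 ln1 mul0r. Qed.

Lemma ray_arg0 : ray_arg 0 = 0.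
Proof. by rewrite /ray_arg /P /Q !mul0r subr0 oppr0 mul0r atan0. Qed.

Lemma clog_ray1 : clog (1 - (x +i* y)) = ray_ln 1 +i* ray_arg 1.
Proof.
have p0 : 0 < 1 - x by have := @ray_re_gt0 1; rewrite mul1r; apply; rewrite ler01 lexx.
rewrite /clog carg_atan/= ?oppr0 ?add0r// /ray_ln /ray_arg /N /P /Q !mul1r.
congr (_ +i* _).
have n0 : 0 < (1 - x) ^+ 2 + (- y) ^+ 2 by rewrite ltr_pwDl ?sqr_ge0// exprn_gt0.
rewrite -[in RHS](sqr_sqrtr (ltW n0)) lnXn ?sqrtr_gt0//.
by rewrite -mulr_natr; field.
Qed.

Lemma clogV_ray1 : clog (1 - (x +i* y))^-1 = - clog (1 - (x +i* y)).
Proof.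
have p0 : 0 < 1 - x by have := @ray_re_gt0 1; rewrite mul1r; apply; rewrite ler01 lexx.
have n0 : 0 < (1 - x) ^+ 2 + (0 - y) ^+ 2 by rewrite ltr_pwDl ?sqr_ge0// exprn_gt0.
rewrite /clog Normc.normcV lnV ?posrE; last by rewrite /= sqrtr_gt0.
rewrite !carg_atan/= ?divr_gt0//.
apply/eqP; rewrite eq_complex /= eqxx /= -atanN; apply/eqP; congr atan; field.
by rewrite sub0r in n0; rewrite (lt0r_neq0 p0) (lt0r_neq0 n0).
Qed.

End Log.

(** * Power series along a ray *)

Section RaySeries.
Variable R : realType.
Implicit Types (c : R^nat) (t : R).

Lemma Re_norm_le (z : R[i]) : `|complex.Re z| <= Normc.normc z.
Proof.
by case: z => p q /=; rewrite -sqrtr_sqr ler_wsqrtr// lerDl sqr_ge0.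
Qed.

Lemma Im_norm_le (z : R[i]) : `|complex.Im z| <= Normc.normc z.
Proof.
by case: z => p q /=; rewrite -sqrtr_sqr ler_wsqrtr// lerDr sqr_ge0.
Qed.

Lemma normcX (z : R[i]) n : Normc.normc (z ^+ n) = Normc.normc z ^+ n.
Proof.
by elim: n => [|n IH]; rewrite ?expr0 ?Normc.normc1// !exprS Normc.normcM IH.
Qed.

Lemma normc_ge0 (z : R[i]) : 0 <= Normc.normc z.
Proof. by case: z => p q /=; exact: sqrtr_ge0. Qed.

Variables (c : R^nat) (u : R[i]).
Hypothesis u1 : Normc.normc u < 1.
Hypothesis cb : forall r, 0 < r < 1 -> geom_bounded c r.

(** Chosen so that 1 < r and r |u| < 1: the ray can be followed slightly beyond
    t = 1. *)
Let r : R := 2 / (1 + Normc.normc u).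
Let f k : R := c k * complex.Re (u ^+ k).
Let g k : R := c k * complex.Im (u ^+ k).

Let r1 : 1 < r.
Proof. by have := normc_ge0 u; move: u1; rewrite /r => u1' u0; rewrite ltr_pdivlMr; lra. Qed.

Let fgb (h : R[i] -> R) : (forall z, `|h z| <= Normc.normc z) ->
  geom_bounded (fun k => c k * h (u ^+ k)) r.
Proof.
move=> hz; move: (normc_ge0 u) (u1) => u0 u1'.
have s01 : 0 < (r * Normc.normc u + 1) / 2 < 1.
  have -> : r * Normc.normc u = 2 * Normc.normc u / (1 + Normc.normc u).
    by rewrite mulrAC.
  have : 2 * Normc.normc u / (1 + Normc.normc u) < 1.
    by rewrite ltr_pdivrMr; lra.
  have : 0 <= 2 * Normc.normc u / (1 + Normc.normc u).
    by rewrite divr_ge0//; lra.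
  by move=> *; apply/andP; split; lra.
have [B hB] := cb s01; exists B => k; apply: le_trans (hB k).
rewrite normrM -mulrA ler_wpM2l//.
apply: (@le_trans _ _ (Normc.normc (u ^+ k) * r ^+ k)).
  by rewrite ler_wpM2r// exprn_ge0// ltW// (lt_trans ltr01).
rewrite normcX -exprMn; have r0 : 0 < r := lt_trans ltr01 r1.
have ru : Normc.normc u * r < 1.
  by rewrite /r mulrA ltr_pdivrMr; lra.
have ru0 : 0 <= Normc.normc u * r by rewrite mulr_ge0// ltW.
by rewrite lerXn2r// ?nnegrE//; [lra | rewrite mulrC; lra].
Qed.

Let fb : geom_bounded f r. Proof. exact: fgb Re_norm_le. Qed.
Let gb : geom_bounded g r. Proof. exact: fgb Im_norm_le. Qed.

(** The real and imaginary parts of S(t) = sum_k c_k (t u)^k. *)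
Definition ray_sum_Re t := limn (pseries f t).
Definition ray_sum_Im t := limn (pseries g t).

Lemma ray_sum_cvg : ccvg (fun n => \sum_(k < n) (c k)%:C * u ^+ k)
  (ray_sum_Re 1 +i* ray_sum_Im 1).
Proof.
have h (s : R^nat) : geom_bounded s r ->
    (fun n => \sum_(k < n) s k) @ \oo --> limn (pseries s 1).
  move=> sb; have : cvgn (pseries s 1).
    by apply: geom_bounded_cvg sb _; rewrite normr1.
  suff -> : (fun n => \sum_(k < n) s k) = pseries s 1 by [].
  apply/funext => n; rewrite /pseries /series/= big_mkord.
  by apply: eq_bigr => k _; rewrite expr1n mulr1.
have reim n : \sum_(k < n) (c k)%:C * u ^+ k =
    (\sum_(k < n) f k) +i* (\sum_(k < n) g k).
  elim: n => [|n IH]; first by rewrite !big_ord0.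
  rewrite !big_ord_recr/= IH /f /g; case: (u ^+ n) => p q /=.
  by apply/eqP; rewrite eq_complex/= !mul0r subr0 addr0 !eqxx.
split => /=.
- by under eq_fun do rewrite reim/=; exact: h.
- by under eq_fun do rewrite reim/=; exact: h.
Qed.

Section Ode.
Variables a b : R.
Hypothesis crec : forall k, k.+1%:R * c k.+1 = (a + k%:R) * c k + (k == 0)%:R * b.

Let x := complex.Re u.
Let y := complex.Im u.

Let diffsE k : pseries_diffs f k = x * ((a + k%:R) * f k) - y * ((a + k%:R) * g k)
   + (k == 0)%:R * b * x /\
  pseries_diffs g k = x * ((a + k%:R) * g k) + y * ((a + k%:R) * f k)
   + (k == 0)%:R * b * y.
Proof.
rewrite /pseries_diffs /f /g !mulrA crec exprSr.
case: k => [|k] /=.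
  rewrite !expr0 mul1r /x /y/= !mul1r; case: u => p q/=.
  split; ring.
rewrite !mul0r !addr0 /x /y; case: (u ^+ k.+1) => p q; case: u => p' q'/=.
split; ring.
Qed.

Let sum_lim (s : R^nat) t : geom_bounded s r -> `|t| < r ->
  (fun n => \sum_(k < n) (a + k%:R) * s k * t ^+ k) @ \oo -->
   a * limn (pseries s t) + t * limn (pseries (pseries_diffs s) t).
Proof.
move=> sb tr.
have -> : (fun n => \sum_(k < n) (a + k%:R) * s k * t ^+ k) =
  (fun n => a * pseries s t n + t * series (fun i => i%:R * s i * t ^+ i.-1) n).
  apply/funext => n; rewrite /pseries /series/= !mulr_sumr -big_split/= big_mkord.
  apply: eq_bigr => -[[|k] ?] _ /=; first by rewrite !mul0r mulr0 !addr0 !expr0; ring.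
  by rewrite exprS; ring.
apply: cvgD.
  by apply: cvgMl_tmp; exact: geom_bounded_cvg sb tr.
apply: cvgMl_tmp; apply: pseries_diffs_equiv.
have t0 : `|t| < (`|t| + r) / 2 by move: tr => *; lra.
apply: geom_bounded_cvg t0.
by apply: geom_bounded_diffs sb => //; move: (normr_ge0 t) => *; lra.
Qed.

(** The recursion for c says that (1 - t u) S' = u (a S + b), written here in
    real and imaginary parts. The binomial series has b = 0 and the logarithm
    has a = 0. *)
Lemma ray_sum_ode t : `|t| < r ->
  exists A' B', [/\ is_derive t 1 ray_sum_Re A', is_derive t 1 ray_sum_Im B',
    A' = x * (a * ray_sum_Re t + t * A') - y * (a * ray_sum_Im t + t * B') + b * x &
    B' = x * (a * ray_sum_Im t + t * B') + y * (a * ray_sum_Re t + t * A') + b * y].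
Proof.
move=> tr; exists (limn (pseries (pseries_diffs f) t)).
exists (limn (pseries (pseries_diffs g) t)).
have dcv (s : R^nat) : geom_bounded s r -> cvgn (pseries (pseries_diffs s) t).
  move=> sb; have t0 : `|t| < (`|t| + r) / 2 by move: tr => *; lra.
  apply: geom_bounded_cvg t0.
  by apply: geom_bounded_diffs sb => //; move: (normr_ge0 t) => *; lra.
have b0 (w : R) : (fun n => \sum_(k < n) (k == 0%N :> nat)%:R * b * w * t ^+ k)
    @ \oo --> b * w.
  rewrite -cvg_shiftS/=.
  suff -> : (fun n => \sum_(k < n.+1) (k == 0%N :> nat)%:R * b * w * t ^+ k) =
    (fun=> b * w) by exact: cvg_cst.
  apply/funext => n; rewrite big_ord_recl/= expr0 big1 ?mul1r ?mulr1 ?addr0//.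
  by move=> k _; rewrite !mul0r.
split; [exact: (geom_bounded_derive fb tr)|exact: (geom_bounded_derive gb tr)| |].
- have e : pseries (pseries_diffs f) t = fun n =>
    x * (\sum_(k < n) (a + k%:R) * f k * t ^+ k) -
    y * (\sum_(k < n) (a + k%:R) * g k * t ^+ k) +
    \sum_(k < n) (k == 0%N :> nat)%:R * b * x * t ^+ k.
    apply/funext => n; rewrite /pseries /series/= big_mkord.
    rewrite !mulr_sumr -sumrB -big_split/=; apply: eq_bigr => k _.
    by rewrite (diffsE k).1; ring.
  rewrite {1}e; apply: cvg_lim => //.
  by apply: cvgD (b0 _); apply: cvgB; apply: cvgMl_tmp;
    [exact: (sum_lim fb tr)|exact: (sum_lim gb tr)].
- have e : pseries (pseries_diffs g) t = fun n =>
    x * (\sum_(k < n) (a + k%:R) * g k * t ^+ k) +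
    y * (\sum_(k < n) (a + k%:R) * f k * t ^+ k) +
    \sum_(k < n) (k == 0%N :> nat)%:R * b * y * t ^+ k.
    apply/funext => n; rewrite /pseries /series/= big_mkord.
    rewrite !mulr_sumr -!big_split/=; apply: eq_bigr => k _.
    by rewrite (diffsE k).2; ring.
  rewrite {1}e; apply: cvg_lim => //.
  by apply: cvgD (b0 _); apply: cvgD; apply: cvgMl_tmp;
    [exact: (sum_lim gb tr)|exact: (sum_lim fb tr)].
Qed.

End Ode.
End RaySeries.

(** * The binomial and logarithmic series *)

Section KernelSeries.
Variable R : realType.

Lemma pseries0 (f : R^nat) : limn (pseries f 0) = f 0%N.
Proof.
apply: cvg_lim => //; rewrite -cvg_shiftS.
suff -> : (fun n => pseries f 0 n.+1) = (fun=> f 0%N) by exact: cvg_cst.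
apply/funext => n; rewrite /pseries /series/= big_mkord big_ord_recl/= expr0.
by rewrite mulr1 big1 ?addr0// => k _; rewrite expr0n/= mulr0.
Qed.

(** The ratio of consecutive terms of c_k r^k tends to r < 1, so that these
    terms eventually decrease. *)
Lemma geom_bounded_rec (c : R^nat) (a b : R) :
  (forall k, 0 <= c k) ->
  (forall k, k.+1%:R * c k.+1 = (a + k%:R) * c k + (k == 0)%:R * b) ->
  forall r, 0 < r < 1 -> geom_bounded c r.
Proof.
move=> c0 cr r /andP[r0 r1].
(* holds as soon as a <= k (1 - r) *)
have [m hm] : exists m, forall k, (m <= k)%N -> (a + k%:R) * r <= k.+1%:R.
  exists (Num.truncn (a / (1 - r))).+1 => k mk.
  have : a / (1 - r) <= k%:R.
    by rewrite (le_trans (ltW (truncnS_gt _)))// ler_nat.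
  rewrite ler_pdivrMr ?subr_gt0// -[k.+1]addn1 natrD => h.
  have k0 : 0 <= k%:R :> R by [].
  have : a * r <= a \/ a <= 0.
    by case: (leP a 0) => [|a0]; [right|left; rewrite ler_piMr// ltW].
  case=> [h'|h'].
    lra.
  have : a * r <= 0 by rewrite mulr_le0_ge0// ltW.
  have : k%:R * r <= k%:R by rewrite ler_piMr// ltW.
  lra.
exists (\sum_(i < m.+2) c i * r ^+ i) => k; rewrite ger0_norm//.
have cr0 i : 0 <= c i * r ^+ i by rewrite mulr_ge0// exprn_ge0// ltW.
have small i : (i < m.+2)%N -> c i * r ^+ i <= \sum_(i < m.+2) c i * r ^+ i.
  by move=> im; rewrite (bigD1 (Ordinal im))//= lerDl sumr_ge0.
have [km|] := ltnP k m.+2; first exact: small.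
move=> mk; rewrite -[k](subnK (ltnW mk)); elim: (k - m.+1)%N => [|j IH]; first exact: small.
apply: le_trans IH; rewrite addSn.
rewrite exprS mulrA ler_wpM2r ?exprn_ge0 ?(ltW r0)//.
rewrite -(@ler_pM2l _ (j + m.+1).+1%:R)// mulrA cr addnS/= mul0r addr0.
rewrite mulrAC ler_wpM2r// -addnS hm//.
by rewrite addnS leqW// leq_addl.
Qed.

Lemma normc_lt1_sqr (x y : R) : Normc.normc (x +i* y) < 1 -> x ^+ 2 + y ^+ 2 < 1.
Proof.
move=> /= h; rewrite -(@sqr_sqrtr _ (x ^+ 2 + y ^+ 2)) ?addr_ge0 ?sqr_ge0//.
by rewrite expr_lt1// sqrtr_ge0.
Qed.

Section RayDerivative.
Variables (c : R^nat) (x y a b : R).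
Hypothesis u1 : Normc.normc (x +i* y) < 1.
Hypothesis c_ge0 : forall k, 0 <= c k.
Hypothesis crec :
  forall k, k.+1%:R * c k.+1 = (a + k%:R) * c k + (k == 0)%:R * b.

Let cb := geom_bounded_rec c_ge0 crec.
Let xy := normc_lt1_sqr u1.
Local Notation S1 := (ray_sum_Re c (x +i* y)).
Local Notation S2 := (ray_sum_Im c (x +i* y)).
Let N (t : R) := (1 - t * x) ^+ 2 + (- (t * y)) ^+ 2.
Let p (t : R) := x * (a * S1 t + b) - y * (a * S2 t).
Let q (t : R) := x * (a * S2 t) + y * (a * S1 t + b).

Lemma ray_norm_gt0 (t : R) : 0 <= t <= 1 -> 0 < N t.
Proof.
by move=> /(ray_re_gt0 xy) p0; rewrite ltr_pwDl ?sqr_ge0// exprn_gt0.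
Qed.

(** The differential equation solved for the derivative: multiply
    (1 - t u) S' = u (a S + b) by the conjugate of 1 - t u. *)
Lemma ray_sum_derive (t : R) : 0 <= t <= 1 ->
  is_derive t 1 S1 (((1 - t * x) * p t - t * y * q t) / N t) /\
  is_derive t 1 S2 (((1 - t * x) * q t + t * y * p t) / N t).
Proof.
move=> t01; have N0 := lt0r_neq0 (ray_norm_gt0 t01).
have tr : `|t| < 2 / (1 + Normc.normc (x +i* y)).
  case/andP: t01 => t0 t1; rewrite ger0_norm// (le_lt_trans t1)//.
  by move: (normc_ge0 (x +i* y)) u1 => *; rewrite ltr_pdivlMr; lra.
have [A [B [dA dB /= eA eB]]] := ray_sum_ode u1 cb crec tr.
have pE : p t = A - t * (x * A - y * B) by rewrite /p [X in _ = X - _]eA; ring.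
have qE : q t = B - t * (x * B + y * A) by rewrite /q [X in _ = X - _]eB; ring.
have -> : ((1 - t * x) * p t - t * y * q t) / N t = A.
  by apply: (canLR (mulfK N0)); rewrite pE qE /N; ring.
have -> : ((1 - t * x) * q t + t * y * p t) / N t = B.
  by apply: (canLR (mulfK N0)); rewrite pE qE /N; ring.
by [].
Qed.

End RayDerivative.

(** Both sides vanish at the start of the ray and have the same derivative
    u / (1 - t u) along it. *)
Lemma log_series (u : R[i]) : Normc.normc u < 1 ->
  ccvg (fun n => \sum_(k < n) ((k%:R^-1 : R)%:C) * u ^+ k) (clog (1 - u)^-1).
Proof.
case: u => x y u1; pose c (k : nat) : R := k%:R^-1.
have crec k : k.+1%:R * c k.+1 = (0 + k%:R) * c k + (k == 0)%:R * 1.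
  rewrite /c divff//; case: k => [|k] /=.
    by rewrite addr0 mul0r add0r mul1r.
  by rewrite add0r divff// mul0r addr0.
have c0 k : 0 <= c k by rewrite /c invr_ge0.
have := ray_sum_cvg u1 (geom_bounded_rec c0 crec); congr ccvg.
have xy := normc_lt1_sqr u1; rewrite clogV_ray1// clog_ray1//.
have d (t : R) : 0 <= t <= 1 ->
    is_derive t 1 (fun s => ray_sum_Re c (x +i* y) s + ray_ln x y s) 0 /\
    is_derive t 1 (fun s => ray_sum_Im c (x +i* y) s + ray_arg x y s) 0.
  move=> t01; have N0 := lt0r_neq0 (ray_norm_gt0 u1 t01).
  have [dA dB] := ray_sum_derive u1 c0 crec t01.
  split; [have h := is_derive_addE dA (ray_ln_derive xy t01)|
          have h := is_derive_addE dB (ray_arg_derive xy t01)];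
    by apply: is_derive_eq h _; field.
have := is_derive0_cst (fun t ht => (d t ht).1).
have := is_derive0_cst (fun t ht => (d t ht).2).
rewrite ray_ln0 ray_arg0 !addr0 /ray_sum_Re /ray_sum_Im !pseries0/= /c invr0 !mul0r.
move=> /eqP; rewrite addr_eq0 => /eqP -> /eqP; rewrite addr_eq0 => /eqP ->.
by apply/eqP; rewrite eq_complex/= !eqxx.
Qed.

(** Along the ray the series S solves (1 - t u) S' = a u S, whose solution with
    S(0) = 1 is the inverse of (1 - t u)^a. *)
Lemma binomial_series (a : R) (c : R^nat) (u : R[i]) : Normc.normc u < 1 ->
  (forall k, 0 <= c k) -> c 0%N = 1 ->
  (forall k, k.+1%:R * c k.+1 = (a + k%:R) * c k) ->
  ccvg (fun n => \sum_(k < n) (c k)%:C * u ^+ k) (cpow (1 - u) a)^-1.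
Proof.
case: u => x y u1 c0 c01 crec'.
have crec k : k.+1%:R * c k.+1 = (a + k%:R) * c k + (k == 0)%:R * 0.
  by rewrite mulr0 addr0.
have := ray_sum_cvg u1 (geom_bounded_rec c0 crec); congr ccvg.
have xy := normc_lt1_sqr u1; rewrite /cpow clog_ray1//.
set A : R -> R := ray_sum_Re c _; set B : R -> R := ray_sum_Im c _.
(* G1 + i G2 is the power (1 - t u)^a along the ray; its product with the sum
   A + i B of the series has derivative 0 and is 1 at t = 0 *)
pose G1 (t : R) : R := expR (a * ray_ln x y t) * cos (a * ray_arg x y t).
pose G2 (t : R) : R := expR (a * ray_ln x y t) * sin (a * ray_arg x y t).
have d (t : R) : 0 <= t <= 1 ->
    is_derive t 1 (fun s => G1 s * A s + - (G2 s * B s)) 0 /\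
    is_derive t 1 (fun s => G1 s * B s + G2 s * A s) 0.
  move=> t01; have N0 := lt0r_neq0 (ray_norm_gt0 u1 t01).
  have [dA dB] := ray_sum_derive u1 c0 crec t01.
  have dl := is_derive_mulE (is_derive_cstE t a) (ray_ln_derive xy t01).
  have dt := is_derive_mulE (is_derive_cstE t a) (ray_arg_derive xy t01).
  have de := @is_derive_compE _ t (@expR R) (fun s => a * ray_ln x y s) _ _
    (is_derive_expR _) dl.
  have dc := @is_derive_compE _ t (@cos R) (fun s => a * ray_arg x y s) _ _
    (is_derive_cos _) dt.
  have ds := @is_derive_compE _ t (@sin R) (fun s => a * ray_arg x y s) _ _
    (is_derive_sin _) dt.
  have d1 := is_derive_mulE de dc; have d2 := is_derive_mulE de ds.
  split; [have h := is_derive_addE (is_derive_mulE d1 dA)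
                      (is_derive_oppE (is_derive_mulE d2 dB))|
          have h := is_derive_addE (is_derive_mulE d1 dB)
                      (is_derive_mulE d2 dA)];
    by apply: is_derive_eq h _; rewrite /A /B; field.
have := is_derive0_cst (fun t ht => (d t ht).1).
have := is_derive0_cst (fun t ht => (d t ht).2).
have -> : G1 0 = 1 by rewrite /G1 ray_ln0 ray_arg0 !mulr0 expR0 cos0 mul1r.
have -> : G2 0 = 0 by rewrite /G2 ray_ln0 ray_arg0 !mulr0 sin0 mulr0.
have -> : A 0 = 1 by rewrite /A /ray_sum_Re pseries0 c01 mul1r.
have -> : B 0 = 0 by rewrite /B /ray_sum_Im pseries0 mulr0.
rewrite !mulr0 !mul0r oppr0 !addr0 mulr1 => e2 e1.
set z := cexp _.
have zE : z = (G1 1 +i* G2 1).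
  rewrite /z /cexp /G1 /G2 /=; apply/eqP.
  by rewrite eq_complex/= !mul0r !subr0 !addr0 !eqxx.
have e : z * (A 1 +i* B 1) = 1.
  by rewrite zE; apply/eqP; rewrite eq_complex/= e1 e2 !eqxx.
have z0 : z != 0 by apply: contra_eq_neq e => ->; rewrite mul0r eq_sym oner_eq0.
by apply: (mulfI z0); rewrite e divff.
Qed.

End KernelSeries.

(** * The multinomial theorem *)

Section Multinomial.
Variable F : numFieldType.
Implicit Types (p q : {poly F}).

Lemma coefM_eq_upto N p p' q q' :
  (forall k, (k < N)%N -> p`_k = p'`_k) -> (forall k, (k < N)%N -> q`_k = q'`_k) ->
  forall k, (k < N)%N -> (p * q)`_k = (p' * q')`_k.
Proof.
move=> pp qq k kN; rewrite !coefM; apply: eq_bigr => -[j /= jk] _.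
by rewrite pp ?qq// (leq_ltn_trans _ kN)// ?leq_subr.
Qed.

Lemma coef_prod_eq_upto N (I : Type) (s : seq I) (p p' : I -> {poly F}) :
  (forall i k, (k < N)%N -> (p i)`_k = (p' i)`_k) ->
  forall k, (k < N)%N -> (\prod_(i <- s) p i)`_k = (\prod_(i <- s) p' i)`_k.
Proof.
move=> pp; elim: s => [|i s IH] k kN; first by rewrite !big_nil.
by rewrite !big_cons; apply: (@coefM_eq_upto N) => // j jN; exact: pp.
Qed.

(** The exponential series of x T cut at degree N. The multinomial theorem is
    the coefficient of T^k in
    exp (x_1 T) ... exp (x_d T) = exp ((x_1 + ... + x_d) T). *)
Definition exp_trunc N (x : F) : {poly F} := \poly_(l < N) (x ^+ l / l`!%:R).

Lemma fact_neq0 n : n`!%:R != 0 :> F.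
Proof. by rewrite pnatr_eq0 -lt0n fact_gt0. Qed.

Lemma coef_prod_exp N d (x : 'I_d -> F) k : (k < N)%N ->
  (\prod_i exp_trunc N (x i))`_k = (\sum_i x i) ^+ k / k`!%:R.
Proof.
elim: d x k => [|d IH] x k kN.
  rewrite !big_ord0 coef1; case: k kN => [|k] kN; first by rewrite expr0 fact0 divr1.
  by rewrite expr0n mul0r.
rewrite !big_ord_recl mulrC addrC coefM exprDn mulr_suml.
rewrite (reindex_inj rev_ord_inj)/=; apply: eq_bigr => -[j /= jk] _.
have jk' : (j <= k)%N by [].
rewrite !subSS subKn// coef_poly (leq_ltn_trans jk' kN) IH; last first.
  by rewrite (leq_ltn_trans _ kN)// leq_subr.
rewrite -mulr_natr -(bin_fact jk') !natrM; field.
by rewrite !fact_neq0 /= pnatr_eq0 -lt0n bin_gt0.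
Qed.

Lemma coef_prod_distr N d (c : 'I_d -> 'I_N -> F) k :
  (\prod_i \sum_(l < N) c i l *: 'X^l)`_k =
  \sum_(al : {ffun 'I_d -> 'I_N} | (\sum_i al i)%N == k) \prod_i c i (al i).
Proof.
rewrite bigA_distr_bigA/= coef_sum [RHS]big_mkcond/=; apply: eq_bigr => al _.
rewrite scaler_prod -expr_sum coefZ coefXn eq_sym.
by case: ifP => _; rewrite ?mulr1 ?mulr0.
Qed.

Lemma multinomial_exp N d (x : 'I_d -> F) k : (k < N)%N ->
  (\sum_i x i) ^+ k / k`!%:R =
  \sum_(al : {ffun 'I_d -> 'I_N} | (\sum_i al i)%N == k)
     \prod_i (x i ^+ al i / (al i)`!%:R).
Proof.
move=> kN; rewrite -(coef_prod_exp x kN).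
rewrite -(coef_prod_distr (fun i (l : 'I_N) => x i ^+ l / l`!%:R)).
by under eq_bigr do rewrite /exp_trunc poly_def.
Qed.

(** Applying T d/dT to each factor exp (x_i T) multiplies the coefficient of
    the index al by the product of the al_i, and multiplies the product by
    x_1 ... x_d T^d. *)
Lemma multinomial_exp_weighted N d (x : 'I_d -> F) m : (m + d < N)%N ->
  \prod_i x i * ((\sum_i x i) ^+ m / m`!%:R) =
  \sum_(al : {ffun 'I_d -> 'I_N} | (\sum_i al i)%N == (m + d)%N)
     \prod_i ((al i)%:R * (x i ^+ al i / (al i)`!%:R)).
Proof.
move=> mN.
rewrite -(coef_prod_distr (fun i (l : 'I_N) => l%:R * (x i ^+ l / l`!%:R))).
rewrite (@coef_prod_eq_upto N _ _ _ (fun i => 'X * (x i *: exp_trunc N (x i))))//.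
  rewrite big_split/= prodr_const card_ord coefXnM ltnNge leq_addl/= addnK.
  rewrite scaler_prod coefZ coef_prod_exp//.
  by rewrite (leq_ltn_trans _ mN)// leq_addr.
move=> i k kN; rewrite -(poly_def N (fun l => l%:R * (x i ^+ l / l`!%:R))).
rewrite coef_poly kN coefXM coefZ; case: k kN => [|k] kN /=; first by rewrite mul0r.
rewrite coef_poly (ltnW kN) exprS factS natrM; field.
by rewrite fact_neq0 addrC natr1 pnatr_eq0.
Qed.

End Multinomial.

(** * Positive kernels *)

Section PositiveKernels.
Variables (R : realType) (X : Type).
Implicit Types (L M : X -> X -> R[i]) (f : X -> R[i]).

Definition positive_kernel L := forall n, npoint_positive n L.

Definition kernel_form n (x : 'I_n -> X) L (s t : 'I_n -> R[i]) : R[i] :=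
  \sum_i \sum_j (s i)^* * L (x i) (x j) * t j.

Lemma npoint_positiveP n L :
  npoint_positive n L <-> forall x (v : 'I_n -> R[i]), 0 <= kernel_form x L v v.
Proof.
split=> h x v; [have := h x v|have := h x v]; congr (0 <= _).
  by apply: eq_bigr => i _; apply: eq_bigr => j _; rewrite mxE.
by apply: eq_bigr => i _; apply: eq_bigr => j _; rewrite mxE.
Qed.

Lemma positive_ext L M : (forall z w, L z w = M z w) -> positive_kernel L ->
  positive_kernel M.
Proof. by move=> e; have -> : M = L by apply/funext => z; apply/funext. Qed.

Lemma positive_lim (u : nat -> X -> X -> R[i]) L :
  (forall n, positive_kernel (u n)) ->
  (forall z w, ccvg (fun n => u n z w) (L z w)) -> positive_kernel L.
Proof.
move=> up uL m; apply/npoint_positiveP => x v.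
apply: (@ccvg_ge0 R (fun n => kernel_form x (u n) v v)).
  by move=> n; have /npoint_positiveP := up n m; apply.
apply: ccvg_sum => i; apply: ccvg_sum => j.
have := ccvgZ ((v i)^* * v j) (uL (x i) (x j)); rewrite mulrAC.
by congr ccvg; apply/funext => n; rewrite mulrAC.
Qed.

Lemma positive_add L M : positive_kernel L -> positive_kernel M ->
  positive_kernel (fun z w => L z w + M z w).
Proof.
move=> Lp Mp n; apply/npoint_positiveP => x v.
have /npoint_positiveP/(_ x v) l0 := Lp n.
have /npoint_positiveP/(_ x v) m0 := Mp n.
have := addr_ge0 l0 m0; rewrite -big_split/=; congr (0 <= _).
apply: eq_bigr => i _; rewrite -big_split/=; apply: eq_bigr => j _.
by rewrite mulrDr mulrDl.
Qed.

Lemma positive_scale L (c : R[i]) : 0 <= c -> positive_kernel L ->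
  positive_kernel (fun z w => c * L z w).
Proof.
move=> c0 Lp n; apply/npoint_positiveP => x v.
have /npoint_positiveP/(_ x v) l0 := Lp n.
have := mulr_ge0 c0 l0; rewrite mulr_sumr; congr (0 <= _).
apply: eq_bigr => i _; rewrite mulr_sumr; apply: eq_bigr => j _.
by rewrite [in RHS]mulrCA !mulrA.
Qed.

Lemma positive_conj L f : positive_kernel L ->
  positive_kernel (fun z w => f z * L z w * (f w)^*).
Proof.
move=> Lp n; apply/npoint_positiveP => x v.
have /npoint_positiveP/(_ x (fun i => (f (x i))^* * v i)) := Lp n.
congr (0 <= _); apply: eq_bigr => i _; apply: eq_bigr => j _.
by rewrite rmorphM/= conjCK; ring.
Qed.

Lemma positive_one : positive_kernel (fun _ _ => 1).
Proof.
move=> n; apply/npoint_positiveP => x v.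
rewrite /kernel_form.
have -> : \sum_i \sum_j (v i)^* * 1 * v j = (\sum_i v i) * (\sum_i v i)^*.
  rewrite rmorph_sum/= mulr_sumr; apply: eq_bigr => i _.
  by rewrite mulr_suml; apply: eq_bigr => j _; ring.
by rewrite -normCK exprn_ge0.
Qed.

Lemma positive_rank1 f : positive_kernel (fun z w => f z * (f w)^*).
Proof.
apply: positive_ext (positive_conj f positive_one) => z w.
by rewrite mulr1.
Qed.

Lemma positive_zero : positive_kernel (fun _ _ => 0).
Proof.
apply: positive_ext (positive_scale (lexx 0) positive_one) => z w.
by rewrite mul0r.
Qed.

Lemma positive_sum (I : Type) (s : seq I) (P : pred I) (L : I -> X -> X -> R[i]) :
  (forall i, P i -> positive_kernel (L i)) ->
  positive_kernel (fun z w => \sum_(i <- s | P i) L i z w).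
Proof.
move=> Lp; elim: s => [|i s IH].
  by apply: positive_ext positive_zero => z w; rewrite big_nil.
case: (boolP (P i)) => Pi.
  apply: positive_ext (positive_add (Lp i Pi) IH) => z w.
  by rewrite big_cons Pi.
by apply: positive_ext IH => z w; rewrite big_cons (negbTE Pi).
Qed.


Lemma sum_sqr_diff (n : nat) (a b : 'I_n -> R[i]) (l : R[i]) :
  \sum_i \sum_j (a i - a j) * l * (b i - b j) =
  2 * (n%:R * (\sum_i a i * l * b i) - (\sum_i a i) * l * (\sum_i b i)).
Proof.
have e1 : \sum_i \sum_j (a i - a j) * l * (b i - b j) =
    \sum_(i < n) \sum_(j < n) a i * l * b i + \sum_(i < n) \sum_(j < n) a j * l * b j
    - (\sum_(i < n) \sum_(j < n) a i * l * b j + \sum_(i < n) \sum_(j < n) a j * l * b i).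
  rewrite -!big_split -sumrB/=; apply: eq_bigr => i _.
  by rewrite -!big_split -sumrB/=; apply: eq_bigr => j _; ring.
rewrite e1.
have -> : \sum_(i < n) \sum_(j < n) a j * l * b i =
  \sum_(i < n) \sum_(j < n) a i * l * b j by rewrite exchange_big.
have -> : \sum_(i < n) \sum_(j < n) a j * l * b j =
  n%:R * \sum_(i < n) (a i * l * b i) by rewrite mulr_natl sumr_const card_ord.
have -> : \sum_(i < n) \sum_(j < n) a i * l * b i =
  n%:R * \sum_(i < n) (a i * l * b i).
  by rewrite mulr_natl exchange_big/= sumr_const card_ord.
have -> : \sum_(i < n) \sum_(j < n) a i * l * b j = (\sum_i a i) * l * (\sum_i b i).
  rewrite -mulrA mulr_suml; apply: eq_bigr => i _.
  by rewrite !mulr_sumr; apply: eq_bigr => j _; rewrite mulrA.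
ring.
Qed.

(** The kernel is half of the sum over i, j of h L h^*, where h = g_i - g_j. *)
Lemma positive_convexity n L (g : 'I_n -> X -> R[i]) : positive_kernel L ->
  positive_kernel (fun z w =>
    n%:R * (\sum_i g i z * L z w * (g i w)^*) -
    (\sum_i g i z) * L z w * (\sum_i g i w)^*).
Proof.
move=> Lp.
have h : positive_kernel (fun z w => 2^-1 * \sum_i \sum_j
    ((g i z - g j z) * L z w * (g i w - g j w)^*)).
  apply: positive_scale; first by rewrite invr_ge0.
  apply: positive_sum => i _; apply: positive_sum => j _.
  exact: (positive_conj (fun z => g i z - g j z)).
apply: positive_ext h => z w.
have -> : \sum_i \sum_j ((g i z - g j z) * L z w * (g i w - g j w)^*) =
  \sum_i \sum_j ((g i z - g j z) * L z w * ((g i w)^* - (g j w)^*)).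
  by apply: eq_bigr => i _; apply: eq_bigr => j _; rewrite rmorphB.
rewrite sum_sqr_diff mulKf ?pnatr_eq0//.
by rewrite rmorph_sum.
Qed.

End PositiveKernels.

(** * Domination of the kernel by its shifts *)

Lemma sum_ord_shift (V : zmodType) n t (F : nat -> V) :
  \sum_(k < n | (t <= k)%N) F (k - t)%N = \sum_(k < n - t) F k.
Proof.
elim: n => [|n IH]; first by rewrite sub0n !big_ord0.
rewrite big_mkcond big_ord_recr -big_mkcond/= IH.
case: leqP => tn; first by rewrite subSn// big_ord_recr.
have /eqP -> : (n.+1 - t == 0)%N by rewrite subn_eq0.
by rewrite addr0; have /eqP -> : (n - t == 0)%N by rewrite subn_eq0 ltnW.
Qed.

Section Domination.
Variables (R : realType) (X : Type) (d : nat) (Z : 'I_d -> X -> R[i]).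

Definition coord_dot (z w : X) : R[i] := \sum_i Z i z * (Z i w)^*.
Definition diag_monomial (z : X) : R[i] := \prod_i ((Num.sqrt d%:R)%:C * Z i z).
Definition diag_kernel (z w : X) : R[i] := diag_monomial z * (diag_monomial w)^*.

Lemma diag_kernelE z w : diag_kernel z w = d%:R ^+ d * \prod_i (Z i z * (Z i w)^*).
Proof.
rewrite /diag_kernel /diag_monomial rmorph_prod/= -big_split/=.
rewrite -[X in _ ^+ X]card_ord -prodr_const -big_split/=; apply: eq_bigr => i _.
rewrite rmorphM/= mulrACA; congr (_ * _).
have -> : ((Num.sqrt d%:R)%:C : R[i])^* = (Num.sqrt d%:R)%:C by exact: conjc_real.
by rewrite -rmorphM/= -expr2 sqr_sqrtr// rmorph_nat.
Qed.

Lemma coord_dot_exp_positive k : positive_kernel (fun z w => coord_dot z w ^+ k).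
Proof.
have h : positive_kernel (fun z w => k`!%:R *
  \sum_(al : {ffun 'I_d -> 'I_k.+1} | (\sum_i al i)%N == k)
    (\prod_i (al i)`!%:R)^-1 *
    (\prod_i Z i z ^+ al i * (\prod_i Z i w ^+ al i)^*)).
  apply: positive_scale => //; apply: positive_sum => al _.
  apply: positive_scale; first by rewrite invr_ge0 prodr_ge0.
  exact: positive_rank1.
apply: positive_ext h => z w.
rewrite /coord_dot -[RHS](@divfK _ k`!%:R); last by rewrite pnatr_eq0 -lt0n fact_gt0.
rewrite mulrC (@multinomial_exp _ k.+1)//; congr (_ * _); apply: eq_bigr => al _.
rewrite -prodfV rmorph_prod -!big_split/=; apply: eq_bigr => i _.
by rewrite exprMn rmorphXn/= mulrC.
Qed.

(** Both terms are combinations of the monomials with exponents al,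
    |al| = m + d, and the coefficients compare because the product of the
    d al_i is at most (m + d)^d, by the inequality of the means. *)
Lemma coord_dot_step_positive m : positive_kernel (fun z w =>
  (m + d)%:R ^+ d * m`!%:R / (m + d)`!%:R * coord_dot z w ^+ (m + d) -
  diag_kernel z w * coord_dot z w ^+ m).
Proof.
pose N := (m + d).+1.
have h : positive_kernel (fun z w => m`!%:R *
  \sum_(al : {ffun 'I_d -> 'I_N} | (\sum_i al i)%N == (m + d)%N)
    (((m + d)%:R ^+ d - \prod_i ((al i)%:R *+ d)) / \prod_i (al i)`!%:R) *
    (\prod_i Z i z ^+ al i * (\prod_i Z i w ^+ al i)^*)).
  apply: positive_scale => //; apply: positive_sum => al /eqP alE.
  apply: positive_scale; last exact: positive_rank1.
  apply: divr_ge0; last by rewrite prodr_ge0.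
  rewrite subr_ge0.
  have := @leif_AGM_scaled R[i] 'I_d predT (fun i => (al i)%:R).
  rewrite -natr_sum cardT size_enum_ord => /(_ _)[].
    by move=> i _; rewrite -mulrnA ler0n.
  by rewrite (eq_bigl predT)// alE.
apply: positive_ext h => z w.
have f0 n : n`!%:R != 0 :> R[i] by rewrite pnatr_eq0 -lt0n fact_gt0.
have -> : (m + d)%:R ^+ d * m`!%:R / (m + d)`!%:R * coord_dot z w ^+ (m + d) =
  m`!%:R * ((m + d)%:R ^+ d * (coord_dot z w ^+ (m + d) / (m + d)`!%:R)) by field.
have -> : diag_kernel z w * coord_dot z w ^+ m = m`!%:R * (d%:R ^+ d *
    (\prod_i (Z i z * (Z i w)^*) * (coord_dot z w ^+ m / m`!%:R))).
  by rewrite diag_kernelE; field.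
rewrite /coord_dot (@multinomial_exp _ N)// (@multinomial_exp_weighted _ N)//.
rewrite -mulrBr; congr (_ * _); rewrite !mulr_sumr -sumrB; apply: eq_bigr => al _.
rewrite mulrBl mulrBl; congr (_ - _).
  rewrite -mulrA; congr (_ * _).
  rewrite -prodfV rmorph_prod -!big_split/=; apply: eq_bigr => i _.
  by rewrite exprMn rmorphXn/= mulrC.
rewrite -[X in d%:R ^+ X]card_ord -prodr_const.
rewrite -prodfV rmorph_prod -!big_split/=; apply: eq_bigr => i _.
by rewrite exprMn rmorphXn/= -mulr_natr; ring.
Qed.

Variable c : R^nat.
Hypothesis c_gt0 : forall k, 0 < c k.

(** For |al| = m and the space with kernel sum_k c_k <z, w>^k, this bounds the
    squared norm of r z^al divided by that of z^al, with equality when all al_i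
    are equal. *)
Definition growth m : R :=
  (m + d)%:R ^+ d * (c m * m`!%:R) / (c (m + d)%N * (m + d)`!%:R).

Lemma growth_ge0 m : 0 <= growth m.
Proof.
by rewrite /growth divr_ge0// ?mulr_ge0// ?exprn_ge0// ltW.
Qed.

Definition growth_prod m j : R := \prod_(i < j) growth (m + d * i).

(** Multiplication by r(z) r(w)^* preserves positivity, so the one-step
    inequality can be iterated. *)
Lemma coord_dot_iter_positive m j : positive_kernel (fun z w =>
  (growth_prod m j * c (m + d * j)%N)%:C * coord_dot z w ^+ (m + d * j) -
  (c m)%:C * diag_kernel z w ^+ j * coord_dot z w ^+ m).
Proof.
elim: j => [|j IH].
  apply: positive_ext (@positive_zero R X) => z w.
  by rewrite /growth_prod big_ord0 !muln0 !addn0 mul1r expr0 mulr1 subrr.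
have p0 : 0 <= growth_prod m j by rewrite prodr_ge0// => i _; exact: growth_ge0.
have h1 := positive_conj diag_monomial IH.
have h2 := @positive_scale R X _ (growth_prod m j * c (m + d * j)%N)%:C _
  (coord_dot_step_positive (m + d * j)).
have := positive_add h1 (h2 _); rewrite ler0c mulr_ge0// ?ltW//; move=> /(_ isT).
apply: positive_ext => z w.
have -> : (growth_prod m j.+1 * c (m + d * j.+1)%N)%:C =
  (growth_prod m j * c (m + d * j)%N)%:C *
   ((m + d * j + d)%:R ^+ d * (m + d * j)`!%:R / (m + d * j + d)`!%:R) :> R[i].
  rewrite /growth_prod big_ord_recr/= /growth mulnS [(d + _)%N]addnC addnA.
  rewrite !rmorphM/= fmorphV/= !rmorphM/= rmorphXn/= !rmorph_nat; field.
  rewrite pnatr_eq0 -lt0n fact_gt0/=.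
  by apply/eqP => /complexI/eqP; rewrite gt_eqF.
rewrite mulnS [(d + _)%N]addnC addnA exprS [diag_kernel z w]lock /diag_kernel -lock; ring.
Qed.

(** The homogeneous part of degree k of [kernel_dominated]. *)
Lemma dominated_positive (A : R) M k :
  \sum_(j < M | (d * j <= k)%N) growth_prod (k - d * j) j <= A ->
  positive_kernel (fun z w => (A * c k)%:C * coord_dot z w ^+ k -
    \sum_(j < M | (d * j <= k)%N)
       (c (k - d * j)%N)%:C * diag_kernel z w ^+ j * coord_dot z w ^+ (k - d * j)).
Proof.
move=> hA.
have h1 := @positive_scale R X _ ((A - \sum_(j < M | (d * j <= k)%N)
   growth_prod (k - d * j) j) * c k)%:C _ (coord_dot_exp_positive k).
have h2 : positive_kernel (fun z w => \sum_(j < M | (d * j <= k)%N)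
  ((growth_prod (k - d * j) j * c (k - d * j + d * j)%N)%:C *
     coord_dot z w ^+ (k - d * j + d * j) -
   (c (k - d * j)%N)%:C * diag_kernel z w ^+ j * coord_dot z w ^+ (k - d * j))).
  by apply: positive_sum => j _; exact: coord_dot_iter_positive.
have := positive_add (h1 _) h2.
rewrite ler0c mulr_ge0 ?subr_ge0 ?(ltW (c_gt0 _))// => /(_ isT).
apply: positive_ext => z w; rewrite sumrB addrA; congr (_ - _).
rewrite (eq_bigr (fun j : 'I_M =>
  (growth_prod (k - d * j) j)%:C * ((c k)%:C * coord_dot z w ^+ k))); last first.
  by move=> j jk; rewrite subnK// rmorphM/= mulrA.
rewrite -mulr_suml -rmorph_sum/= !rmorphM/= rmorphB/=; ring.
Qed.

Variable K : X -> X -> R[i].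
Hypothesis Kseries : forall z w,
  ccvg (fun n => \sum_(k < n) (c k)%:C * coord_dot z w ^+ k) (K z w).

Lemma kernel_positive : positive_kernel K.
Proof.
apply: positive_lim Kseries => n; apply: positive_sum => k _.
by apply: positive_scale (coord_dot_exp_positive k); rewrite ler0c ltW.
Qed.

Lemma kernel_dominated (A : R) M :
  (forall k, \sum_(j < M | (d * j <= k)%N) growth_prod (k - d * j) j <= A) ->
  positive_kernel (fun z w => A%:C * K z w - \sum_(j < M) diag_kernel z w ^+ j * K z w).
Proof.
move=> hA.
apply: (@positive_lim _ _ (fun n z w => \sum_(k < n) ((A * c k)%:C * coord_dot z w ^+ k -
    \sum_(j < M | (d * j <= k)%N)
       (c (k - d * j)%N)%:C * diag_kernel z w ^+ j * coord_dot z w ^+ (k - d * j)))).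
  by move=> n; apply: positive_sum => k _; exact: dominated_positive.
move=> z w.
have h : ccvg (fun n => A%:C * (\sum_(k < n) (c k)%:C * coord_dot z w ^+ k) +
   - 1 * (\sum_(j < M) diag_kernel z w ^+ j * (\sum_(k < n - d * j) (c k)%:C * coord_dot z w ^+ k)))
   (A%:C * K z w + - 1 * (\sum_(j < M) diag_kernel z w ^+ j * K z w)).
  apply: ccvgD; first exact: ccvgZ.
  apply: ccvgZ; apply: ccvg_sum => j; apply: ccvgZ.
  exact: (@ccvg_shift R (fun n => \sum_(k < n) (c k)%:C * coord_dot z w ^+ k)).
move: h; rewrite mulN1r; congr ccvg; apply/funext => n.
rewrite sumrB mulN1r; congr (_ - _).
  by rewrite mulr_sumr; apply: eq_bigr => k _; rewrite rmorphM/= mulrA.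
rewrite [RHS](eq_bigr (fun k : 'I_n => \sum_(j < M) if (d * j <= k)%N then
  (c (k - d * j)%N)%:C * diag_kernel z w ^+ j * coord_dot z w ^+ (k - d * j) else 0)); last first.
  by move=> k _; rewrite big_mkcond.
rewrite exchange_big/=; apply: eq_bigr => j _.
rewrite -big_mkcond/= mulr_sumr.
rewrite (sum_ord_shift n (d * j) (fun k => (c k)%:C * diag_kernel z w ^+ j * coord_dot z w ^+ k)).
by apply: eq_bigr => k _; rewrite mulrCA mulrA.
Qed.

End Domination.

(** * Sums of growth factors *)

Section Growth.
Variables (R : realType) (d : nat) (c : R^nat).
Hypothesis d_gt0 : (0 < d)%N.
Hypothesis c_gt0 : forall k, 0 < c k.
Let g := growth d c.
Hypothesis g_dec : forall m, g m.+1 <= g m.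
Variables (s b : R).
Hypothesis s_gt0 : 0 < s.
Hypothesis b_gt0 : 0 < b.
Hypothesis g_ge : forall m, 1 + s / (b + m%:R) <= g m.

(** When c 0 = 1 this is the squared norm of the N-th power of
    [diag_monomial]. *)
Definition diag_norm2 N : R := growth_prod d c 0 N.

Let g_ge1 m : 1 <= g m.
Proof.
apply: le_trans (g_ge m); rewrite lerDl divr_ge0 ?(ltW s_gt0)//.
by rewrite addr_ge0// ltW.
Qed.

Let g_anti m n : (m <= n)%N -> g n <= g m.
Proof.
by move=> /subnK <-; elim: (n - m)%N => // k IH; exact: le_trans (g_dec _) IH.
Qed.

Lemma diag_norm2S N : diag_norm2 N.+1 = diag_norm2 N * g (d * N).
Proof. by rewrite /diag_norm2 /growth_prod big_ord_recr/= add0n. Qed.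

Lemma diag_norm2_gt0 N : 0 < diag_norm2 N.
Proof.
rewrite /diag_norm2 /growth_prod prodr_gt0// => i _.
exact: lt_le_trans ltr01 (g_ge1 _).
Qed.

Lemma le_diag_norm2 M N : (M <= N)%N -> diag_norm2 M <= diag_norm2 N.
Proof.
move=> /subnK <-; elim: (N - M)%N => // k IH; apply: le_trans IH _.
by rewrite addSn diag_norm2S ler_peMr// ltW// diag_norm2_gt0.
Qed.

(** As the growth decreases, the j factors starting at degree k - d j are at
    most the j factors leading from the diagonal degree d (t - j) to d t. *)
Lemma growth_prod_le k j t : (j <= t)%N -> (d * t <= k)%N ->
  growth_prod d c (k - d * j) j <= diag_norm2 t / diag_norm2 (t - j).
Proof.
move=> jt tk; rewrite ler_pdivlMr ?diag_norm2_gt0//.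
have -> : diag_norm2 t = \prod_(i < j) g (d * (t - j) + d * i) * diag_norm2 (t - j).
  rewrite -{1}(subnKC jt); move: (t - j)%N => n.
  elim: j {jt} => [|j IH]; first by rewrite add0n big_ord0 mul1r.
  by rewrite addSn diag_norm2S IH big_ord_recr/= mulnDr [(d * j + _)%N]addnC mulrAC.
rewrite ler_wpM2r ?(ltW (diag_norm2_gt0 _))//; apply: ler_prod => i _.
rewrite growth_ge0//=; apply: g_anti.
by rewrite mulnBr leq_add2r leq_sub2r.
Qed.

Definition domination_cst M : R := diag_norm2 M * \sum_(i < M) (diag_norm2 i)^-1.

(** With t the minimum of k / d and M - 1, the j-th product is at most
    omega_t / omega_(t - j), and the inverses of the omega_(t - j) make up a
    partial sum of the series of 1 / omega_i. *)
Lemma growth_prod_sum_le M k :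
  \sum_(j < M | (d * j <= k)%N) growth_prod d c (k - d * j) j <= domination_cst M.
Proof.
case: M => [|M]; first by rewrite /domination_cst !big_ord0 mulr0.
pose t := minn (k %/ d) M.
have tk : (d * t <= k)%N.
  by rewrite mulnC (leq_trans _ (leq_trunc_div k d))// leq_mul2r geq_minl orbT.
have jt (j : 'I_M.+1) : (d * j <= k)%N -> (j <= t)%N.
  move=> jk; rewrite leq_min -[(j <= M)%N]ltnS ltn_ord andbT.
  by rewrite leq_divRL// mulnC.
apply: (@le_trans _ _ (\sum_(j < M.+1 | (j < t.+1)%N) diag_norm2 M.+1 / diag_norm2 (t - j))).
  rewrite big_mkcond [leRHS]big_mkcond/=; apply: ler_sum => j _.
  case: ifPn => [jk|_]; last first.
    by case: ifP => // _; rewrite divr_ge0// ltW// diag_norm2_gt0.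
  rewrite ltnS (jt j jk); apply: le_trans (growth_prod_le (jt j jk) tk) _.
  rewrite ler_wpM2r ?invr_ge0 ?(ltW (diag_norm2_gt0 _))// le_diag_norm2//.
  by rewrite (leq_trans (geq_minr _ _)).
have tM : (t.+1 <= M.+1)%N by rewrite ltnS geq_minr.
rewrite -(big_ord_widen_cond _ predT (fun j => diag_norm2 M.+1 / diag_norm2 (t - j)) tM).
rewrite -mulr_sumr ler_wpM2l ?(ltW (diag_norm2_gt0 _))//.
rewrite (reindex_inj rev_ord_inj)/=.
rewrite (eq_bigr (fun i : 'I_t.+1 => (diag_norm2 i)^-1)); last first.
  by move=> i _; rewrite subSS subKn// -ltnS.
rewrite (big_ord_widen_cond _ predT (fun i => (diag_norm2 i)^-1) tM).
rewrite [leRHS](bigID (fun i : 'I_M.+1 => (i < t.+1)%N))/= lerDl sumr_ge0// => i _.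
by rewrite invr_ge0 ltW// diag_norm2_gt0.
Qed.

(** Since growth (d N) exceeds 1 by a multiple of 1 / (N + 1), the norms
    dominate a multiple of the harmonic series. *)
Lemma diag_norm2V_cvg0 : (fun N => (diag_norm2 N)^-1) @ \oo --> (0 : R).
Proof.
apply/gtr0_cvgV0; first by near=> n; exact: diag_norm2_gt0.
have low N : s / (b + d%:R) * series harmonic N <= diag_norm2 N.
  elim: N => [|N IH]; first by rewrite /series/= big_geq// mulr0 ltW// diag_norm2_gt0.
  rewrite diag_norm2S seriesSr mulrDr.
  have l1 : 1 <= diag_norm2 N.
    by have := le_diag_norm2 (leq0n N); rewrite {1}/diag_norm2 /growth_prod big_ord0.
  have h : 1 + s / (b + d%:R) * harmonic N <= g (d * N).
    apply: le_trans (g_ge _); rewrite lerD2l -mulrA ler_wpM2l ?(ltW s_gt0)//.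
    rewrite /harmonic/= -invfM lef_pV2 ?posrE; last 2 first.
    - by rewrite mulr_gt0// addr_gt0// ltr0n.
    - by rewrite ltr_pwDl.
    by rewrite mulrDl natrM lerD// ?ler_peMr// ?(ltW b_gt0)// ?ler1n// ler_wpM2l// ler_nat.
  apply: (@le_trans _ _ (diag_norm2 N * (1 + s / (b + d%:R) * harmonic N))).
    rewrite mulrDr mulr1 lerD// ler_peMl// mulr_ge0 ?harmonic_ge0//.
    by rewrite divr_ge0 ?addr_ge0// ?ltW.
  by rewrite ler_wpM2l// ltW// diag_norm2_gt0.
have k0 : 0 < s / (b + d%:R) by rewrite divr_gt0// ltr_pwDl.
apply/cvgryPge => A.
have dv : series (@harmonic R) @ \oo --> +oo.
  apply: nondecreasing_dvgn_lt; last exact: dvg_harmonic.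
  by apply: nondecreasing_series => n _ _; exact: harmonic_ge0.
move/cvgryPge: dv => /(_ (A / (s / (b + d%:R))))[N _ hN].
exists N => // n /= Nn; apply: le_trans (low n).
by rewrite mulrC -ler_pdivrMr//; exact: hN.
Unshelve. all: by end_near. Qed.

Lemma diag_norm2V_mean (e : R) : 0 < e ->
  exists N, forall M, (N <= M)%N -> \sum_(i < M) (diag_norm2 i)^-1 <= e * M%:R.
Proof.
move=> e0; have := cesaro diag_norm2V_cvg0.
move=> /cvgrPdist_le /(_ e e0)[N _ hN]; exists N.+1 => -[//|M] NM.
have := hN M NM; rewrite /arithmetic_mean/= sub0r normrN.
rewrite ger0_norm; last first.
  by rewrite mulr_ge0// sumr_ge0// => i _; rewrite invr_ge0 ltW// diag_norm2_gt0.
by rewrite /series/= big_mkord mulrC ler_pdivrMr.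
Qed.

End Growth.

(** * The coefficients of the kernels *)

Section DaCoef.
Variables (R : realType) (d : nat).
Hypothesis d_gt0 : (0 < d)%N.
Implicit Types (a : R).

Definition rising a m n : R := \prod_(i < n) (a + m%:R + i%:R).

(** The Taylor coefficients in <z, w> of the kernel. *)
Definition Da_coef a (k : nat) : R :=
  if a == 0 then k.+1%:R^-1 else rising a 0 k / k`!%:R.

Lemma rising_gt0 a m n : 0 < a -> 0 < rising a m n.
Proof. by move=> a0; rewrite prodr_gt0// => i _; rewrite ltr_pwDl// ltr_pwDl. Qed.

Lemma risingD a m n : rising a 0 (m + n) = rising a 0 m * rising a m n.
Proof.
rewrite /rising big_split_ord/=; congr (_ * _); apply: eq_bigr => i _.
by rewrite addr0 natrD addrA.
Qed.

Lemma risingS a m n : rising a m n.+1 = (a + m%:R) * rising a m.+1 n.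
Proof.
rewrite /rising big_ord_recl addr0; congr (_ * _); apply: eq_bigr => i _.
by rewrite /bump/= -addrA -[in RHS]addrA -!natrD addSnnS.
Qed.

Lemma risingSr a m n : rising a m n.+1 = rising a m n * (a + m%:R + n%:R).
Proof. by rewrite /rising big_ord_recr. Qed.

Let fact_neq0R n : n`!%:R != 0 :> R.
Proof. by rewrite pnatr_eq0 -lt0n fact_gt0. Qed.

Lemma Da_coef_gt0 a k : 0 <= a -> 0 < Da_coef a k.
Proof.
rewrite /Da_coef le_eqVlt eq_sym; case: eqP => [_ _|_ /= a0].
  by rewrite invr_gt0.
by rewrite divr_gt0 ?rising_gt0// ltr0n fact_gt0.
Qed.

Lemma Da_coef0 a : Da_coef a 0 = 1.
Proof. by rewrite /Da_coef /rising big_ord0 fact0 divr1 invr1; case: ifP. Qed.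

Lemma Da_coef_rec a k : a != 0 ->
  k.+1%:R * Da_coef a k.+1 = (a + k%:R) * Da_coef a k.
Proof.
move=> /negbTE a0; rewrite /Da_coef a0 risingSr factS natrM addr0.
by field; rewrite fact_neq0R addrC natr1 pnatr_eq0.
Qed.

Definition Da_growth a m : R := (m + d)%:R ^+ d / rising a m d.

Lemma growth_Da a m : 0 < a -> growth d (Da_coef a) m = Da_growth a m.
Proof.
move=> a0; rewrite /growth /Da_growth /Da_coef gt_eqF// risingD.
have m0 := lt0r_neq0 (rising_gt0 0 m a0).
have d0 := lt0r_neq0 (rising_gt0 m d a0).
by field; rewrite !fact_neq0R m0 d0.
Qed.

Lemma rising1_fact m : rising 1 0 m = m`!%:R.
Proof.
elim: m => [|m IH]; first by rewrite /rising big_ord0.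
by rewrite risingSr IH addr0 nat1r factS mulrC natrM.
Qed.

(** The coefficient 1 / (k + 1) is the one for a = 1 divided by k + 1. *)
Lemma growth_D0 m : growth d (Da_coef 0) m = Da_growth 1 m * (1 + d%:R / (1 + m%:R)).
Proof.
rewrite /growth /Da_growth /Da_coef eqxx -(rising1_fact (m + d)) risingD rising1_fact.
have d0 := lt0r_neq0 (@rising_gt0 1 m d ltr01).
field; rewrite !fact_neq0R d0 /=.
by rewrite -natrD !nat1r !pnatr_eq0.
Qed.

(** The case a = (d + 1) / 2 of [Da_growth_dec], with K = m + d. In the
    induction step, two cubic polynomials in K differ by e (e + 1). *)
Lemma pow_succ_le (K : R) e : e%:R <= K ->
  (K + 1) ^+ e * (2 * K + 1 - e%:R) <= K ^+ e * (2 * K + 1 + e%:R).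
Proof.
elim: e => [|e IH] eK; first by rewrite !expr0 subr0 addr0.
have e0 : 0 <= e%:R :> R by [].
rewrite -natr1 in eK *.
have {}IH : (K + 1) ^+ e * (2 * K + 1 - e%:R) <= K ^+ e * (2 * K + 1 + e%:R).
  by apply: IH; lra.
have p0 : 0 < 2 * K + 1 - e%:R by lra.
rewrite -(ler_pM2l p0) !exprS.
apply: (@le_trans _ _ ((K ^+ e * (2 * K + 1 + e%:R)) * ((K + 1) * (2 * K - e%:R)))).
  rewrite [leLHS](_ : _ = ((K + 1) ^+ e * (2 * K + 1 - e%:R)) *
    ((K + 1) * (2 * K - e%:R))); last ring.
  by rewrite ler_wpM2r// mulr_ge0//; lra.
have Ke : 0 <= K ^+ e by rewrite exprn_ge0//; lra.
rewrite -subr_ge0.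
have -> : (2 * K + 1 - e%:R) * (K * K ^+ e * (2 * K + 1 + (e%:R + 1))) -
  K ^+ e * (2 * K + 1 + e%:R) * ((K + 1) * (2 * K - e%:R)) =
  K ^+ e * (e%:R * (e%:R + 1)) by ring.
by rewrite !mulr_ge0// addr_ge0.
Qed.

(** The quotient of two consecutive values is
    ((m + 1 + d) / (m + d))^d (a + m) / (a + m + d), which increases with a; so
    only the largest a matters. *)
Lemma Da_growth_dec a m : 0 < a -> a <= d.+1%:R / 2 ->
  Da_growth a m.+1 <= Da_growth a m.
Proof.
move=> a0 ad; rewrite /Da_growth.
have r0 := rising_gt0 m d a0; have r1 := rising_gt0 m.+1 d a0.
have am : 0 < a + m%:R by rewrite ltr_pwDl.
rewrite ler_pdivrMr// mulrAC ler_pdivlMr// -(ler_pM2r am).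
have -> : (m + d)%:R ^+ d * rising a m.+1 d * (a + m%:R) =
  ((m + d)%:R ^+ d * (a + m%:R + d%:R)) * rising a m d.
  by rewrite -[LHS]mulrA [rising _ _ _ * _]mulrC -risingS risingSr; ring.
rewrite mulrAC ler_wpM2r ?(ltW r0)// addSn -natr1.
set K : R := (m + d)%:R.
have dK : d%:R <= K by rewrite ler_nat leq_addl.
have := pow_succ_le dK; set p := (K + 1) ^+ d; set q := K ^+ d => h.
have qp : q <= p by rewrite lerXn2r ?nnegrE ?addr_ge0 ?lerDl ?ler0n.
have aK : a + m%:R = K + a - d%:R by rewrite /K natrD; ring.
rewrite aK -natr1 in ad *.
have : 0 <= (d%:R + 1 - 2 * a) * (p - q) by rewrite mulr_ge0//; lra.
lra.
Qed.

Lemma rising_le a m : 0 <= a -> rising a m d <= (a + m%:R + (d%:R - 1) / 2) ^+ d.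
Proof.
move=> a0.
have := @leif_AGM R 'I_d predT (fun i => a + m%:R + i%:R).
rewrite cardT size_enum_ord => /(_ _)[].
  by move=> i _; rewrite !addr_ge0.
move=> + _; rewrite /rising; congr (_ <= _ ^+ _).
have d0 : d%:R != 0 :> R by rewrite pnatr_eq0 -lt0n.
have sumi n : \sum_(i < n) i%:R = (n%:R - 1) / 2 * n%:R :> R.
  elim: n => [|n IH]; first by rewrite big_ord0 mulr0.
  by rewrite big_ord_recr/= IH -natr1; field.
rewrite big_split/= sumr_const cardT size_enum_ord -mulr_natr sumi.
by field.
Qed.

(** At b = (d + 1) / 2 the inequality of the means gives
    rising b m d <= (m + d)^d. Passing from b down to a in the first factor
    alone gains (b + m) / (a + m). *)
Lemma Da_growth_ge a m : 0 < a -> a <= d.+1%:R / 2 ->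
  1 + (d.+1%:R / 2 - a) / (a + m%:R) <= Da_growth a m.
Proof.
move=> a0 ad; rewrite /Da_growth.
have am : 0 < a + m%:R by rewrite ltr_pwDl.
have r0 := rising_gt0 m d a0.
pose b : R := d.+1%:R / 2.
have -> : 1 + (d.+1%:R / 2 - a) / (a + m%:R) = (b + m%:R) / (a + m%:R).
  by rewrite /b; field; rewrite lt0r_neq0.
rewrite ler_pdivlMr// mulrAC ler_pdivrMr//.
apply: (@le_trans _ _ ((a + m%:R) * rising b m d)).
  case: d d_gt0 => // e _; rewrite !risingS.
  rewrite mulrCA ler_wpM2l ?(ltW am)// ler_wpM2l//.
    by rewrite /b addr_ge0// divr_ge0.
  apply: ler_prod => i _; rewrite !addr_ge0 ?(ltW a0)//=.
  by rewrite !lerD2r.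
rewrite mulrC ler_wpM2r ?(ltW am)//.
apply: le_trans (rising_le _ _) _; first by rewrite divr_ge0.
by rewrite (_ : b + m%:R + (d%:R - 1) / 2 = (m + d)%:R)// /b natrD -natr1; field.
Qed.

Lemma Da_coef_growth_dec a m : 0 <= a -> a <= d.+1%:R / 2 ->
  growth d (Da_coef a) m.+1 <= growth d (Da_coef a) m.
Proof.
rewrite le_eqVlt => /predU1P[<- _|a0 ad]; last first.
  by rewrite !growth_Da//; exact: Da_growth_dec.
rewrite !growth_D0; apply: ler_pM.
- by rewrite divr_ge0 ?exprn_ge0// ltW// rising_gt0.
- by rewrite addr_ge0// divr_ge0// addr_ge0.
- apply: Da_growth_dec => //; rewrite ler_pdivlMr// mul1r ler_nat.
  by rewrite ltnS.
- rewrite lerD2l ler_wpM2l// lef_pV2 ?posrE ?ltr_pwDl//.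
  by rewrite lerD2l ler_nat.
Qed.

Lemma Da_coef_growth_ge a : 0 <= a -> a < d.+1%:R / 2 ->
  exists s b : R, [/\ 0 < s, 0 < b &
    forall m, 1 + s / (b + m%:R) <= growth d (Da_coef a) m].
Proof.
rewrite le_eqVlt => /predU1P[<- _|a0 ad]; last first.
  exists (d.+1%:R / 2 - a), a; split; [by rewrite subr_gt0|by []|].
  by move=> m; rewrite growth_Da//; apply: Da_growth_ge => //; exact: ltW.
exists d%:R, 1; split; [by rewrite ltr0n|by []|] => m.
rewrite growth_D0 ler_peMl ?addr_ge0 ?divr_ge0 ?addr_ge0//.
have d1 : 1 <= d.+1%:R / 2 :> R by rewrite ler_pdivlMr// mul1r ler_nat ltnS.
apply: le_trans (Da_growth_ge m ltr01 d1); by rewrite lerDl divr_ge0 ?subr_ge0// addr_ge0.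
Qed.

End DaCoef.

(** * Interpolation on the disc with small coefficients *)

Section Interpolation.
Variable C : numFieldType.
Implicit Types (p q : {poly C}).

(** Young's inequality: a convolution is bounded by the maximum of one factor
    times the l^1 norm of the other. *)
Lemma coef_mul_bound p q (A B : C) N k :
  (forall i, `|p`_i| <= A) -> (forall i, (N <= i)%N -> q`_i = 0) ->
  \sum_(i < N) `|q`_i| <= B -> 0 <= A -> `|(p * q)`_k| <= A * B.
Proof.
move=> pA qN qB A0; rewrite mulrC coefM.
apply: le_trans (ler_norm_sum _ _ _) _.
apply: (@le_trans _ _ (\sum_(i < k.+1) A * `|q`_i|)).
  by apply: ler_sum => i _; rewrite normrM mulrC ler_wpM2r.
rewrite -mulr_sumr ler_wpM2l//; apply: le_trans qB.
have mono m n : (m <= n)%N -> \sum_(i < m) `|q`_i| <= \sum_(i < n) `|q`_i|.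
  move=> mn; rewrite (big_ord_widen_cond _ predT (fun i => `|q`_i|) mn).
  by rewrite [leRHS](bigID (fun i : 'I_n => (i < m)%N))/= lerDl sumr_ge0.
have [kN|Nk] := leqP k.+1 N; first exact: mono.
rewrite -(subnKC (ltnW Nk)) big_split_ord/= [X in _ + X]big1 ?addr0//.
by move=> i _; rewrite qN ?normr0// leq_addr.
Qed.

(** The factor X^L - (1 / L) sum_(1 <= j <= L) m^j X^(L - j) vanishes at m; the
    part below its leading term has l^1 norm at most 1 and coefficients at most
    1 / L. Multiplying by one more such factor at most doubles the bound on the
    coefficients and adds 1 / L. *)
Lemma interpolation_bounded n (mu : 'I_n -> C) L : (0 < L)%N ->
  (forall i, `|mu i| <= 1) ->
  exists b : nat -> C,
    (forall k, `|b k| <= (2 ^+ n - 1) / L%:R) /\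
    forall i, mu i ^+ (n * L) = \sum_(k < n * L) b k * mu i ^+ k.
Proof.
move=> L0 mu1.
have Ln : L%:R != 0 :> C by rewrite pnatr_eq0 -lt0n.
suff [q [qn qb qr]] : exists q : {poly C}, [/\ (size q <= n * L)%N,
    forall k, `|q`_k| <= (2 ^+ n - 1) / L%:R &
    forall i, ('X^(n * L) - q).[mu i] = 0].
  exists (fun k => q`_k); split=> // i; have := qr i.
  rewrite hornerD hornerN hornerXn => /eqP; rewrite subr_eq0 => /eqP ->.
  by rewrite (horner_coef_wide _ qn).
elim: n mu mu1 => [|n IH] mu mu1.
  exists 0; split; [by rewrite size_poly0| |by case].
  by move=> k; rewrite coef0 normr0 expr0 subrr mul0r.
have [q [qn qb qr]] := IH (fun i => mu (lift ord0 i)) (fun i => mu1 _).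
pose m := mu ord0; have m1 : `|m| <= 1 by exact: mu1.
(* the average that replaces X^L at the new node m *)
pose g : {poly C} := \poly_(j < L) (m ^+ (L - j) / L%:R).
have gb : \sum_(i < L) `|g`_i| <= 1.
  apply: (@le_trans _ _ (\sum_(i < L) L%:R^-1)).
    apply: ler_sum => i _; rewrite coef_poly ltn_ord normrM normfV normr_nat.
    by rewrite ler_piMl ?invr_ge0// normrX exprn_ile1.
  by rewrite sumr_const card_ord -[_ *+ L]mulr_natl divff.
have gL i : (L <= i)%N -> g`_i = 0 by move=> Li; rewrite coef_poly ltnNge Li.
have gm : ('X^L - g).[m] = 0.
  rewrite hornerD hornerN hornerXn horner_poly.
  rewrite (eq_bigr (fun=> m ^+ L / L%:R)); last first.
    by move=> i _; rewrite mulrAC -exprD subnK// ltnW.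
  by rewrite sumr_const card_ord -[_ *+ L]mulr_natl mulrCA divff// mulr1 subrr.
have size_g : (size g <= L)%N by exact: size_poly.
have fact : 'X^(n.+1 * L) - (q * 'X^L + 'X^(n * L) * g - q * g) =
    ('X^(n * L) - q) * ('X^L - g).
  by rewrite mulSn addnC exprD; ring.
exists (q * 'X^L + 'X^(n * L) * g - q * g); split.
- rewrite mulSn (leq_trans (size_polyD _ _))// geq_max size_polyN; apply/andP; split.
    rewrite (leq_trans (size_polyD _ _))// geq_max; apply/andP; split.
      rewrite (leq_trans (size_polyMleq _ _))// size_polyXn addnS/=.
      by rewrite addnC leq_add2l.
    rewrite (leq_trans (size_polyMleq _ _))// size_polyXn addSn/=.
    by rewrite addnC leq_add2r.
  rewrite (leq_trans (size_polyMleq _ _))// (leq_trans (leq_pred _))//.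
  by rewrite addnC leq_add.
- move=> k.
  have c0 : 0 <= (2 ^+ n - 1) / L%:R :> C.
    by rewrite divr_ge0// subr_ge0 exprn_ege1// ler1n.
  apply: (@le_trans _ _ ((2 ^+ n - 1) / L%:R + L%:R^-1 + (2 ^+ n - 1) / L%:R * 1)); last first.
    by rewrite le_eqVlt; apply/orP; left; apply/eqP; rewrite exprS; field.
  rewrite coefB; apply: le_trans (ler_normB _ _) _; apply: lerD; last first.
    exact: (coef_mul_bound _ qb gL gb c0).
  rewrite coefD; apply: le_trans (ler_normD _ _) _; apply: lerD.
    by rewrite coefMXn; case: ifP => _ //; rewrite normr0.
  rewrite coefXnM; case: ifP => _; first by rewrite normr0 invr_ge0.
  rewrite coef_poly; case: ifP => _; last by rewrite normr0 invr_ge0.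
  by rewrite normrM normfV normr_nat ler_piMl ?invr_ge0// normrX exprn_ile1.
- move=> i; rewrite fact hornerM.
  by case: (unliftP ord0 i) => [j ->|->]; [rewrite qr mul0r|rewrite gm mulr0].
Qed.

End Interpolation.

(** * Reproducing kernel Hilbert spaces *)

Section Rkhs.
Variables (R : realType) (X : Type) (K : X -> X -> R[i]) (H : rkhs K).
Implicit Types (f g h : X -> R[i]) (c : R[i]).

Local Notation ip := (rk_inner H).
Local Notation car := (rk_carrier H).
Local Notation Re := complex.Re.
Local Notation Im := complex.Im.

Definition sqmod c : R := Re c ^+ 2 + Im c ^+ 2.

Lemma sqmod_ge0 c : 0 <= sqmod c.
Proof. by rewrite /sqmod addr_ge0 ?sqr_ge0. Qed.

Lemma sqmod_eq0 c : sqmod c = 0 -> c = 0.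
Proof.
case: c => p q /eqP; rewrite /sqmod/= paddr_eq0 ?sqr_ge0// !sqrf_eq0.
by move=> /andP[/eqP -> /eqP ->].
Qed.

Lemma sqmodD_le c c' : sqmod (c + c') <= 2 * sqmod c + 2 * sqmod c'.
Proof.
case: c; case: c' => p q r s; rewrite /sqmod/=.
by have := sqr_ge0 (r - p); have := sqr_ge0 (s - q); rewrite !sqrrB !sqrrD; lra.
Qed.

Lemma rkhs_add f g : car f -> car g -> car (f + g).
Proof. by move=> cf cg; rewrite -[f]scale1r; exact: rk_linear. Qed.

Lemma rkhs_scale c f : car f -> car (c *: f).
Proof. by move=> cf; rewrite -[_ *: _]addr0; apply: rk_linear => //; exact: rk_zero. Qed.

Lemma rkhs_sub f g : car f -> car g -> car (f - g).
Proof.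
by move=> cf cg; rewrite addrC -scaleN1r; exact: rk_linear.
Qed.

Definition hnorm2 f : R := Re (ip f f).

Lemma ip_conj f g : car f -> car g -> ip g f = (ip f g)^*.
Proof. by move=> cf cg; exact: (rk_inner_conj cf cg). Qed.

Lemma ip_linear_l c f g h : car f -> car g -> car h ->
  ip (g + c *: f) h = ip g h + c * ip f h.
Proof.
by move=> cf cg ch; rewrite addrC rk_inner_linear// addrC.
Qed.

Lemma ip_linear_r c f g h : car f -> car g -> car h ->
  ip h (g + c *: f) = ip h g + c^* * ip h f.
Proof.
move=> cf cg ch.
have cgf : car (g + c *: f) by apply: rkhs_add => //; exact: rkhs_scale.
rewrite (ip_conj cgf ch) ip_linear_l// rmorphD rmorphM/=.
by rewrite -(ip_conj cg ch) -(ip_conj cf ch).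
Qed.

Lemma ip_self f : car f -> ip f f = (hnorm2 f)%:C.
Proof.
move=> cf; have := ip_conj cf cf; rewrite /hnorm2.
case: (ip f f) => p q /= [/eqP]; rewrite -subr_eq0 opprK -mulr2n mulrn_eq0/=.
by move=> /eqP ->.
Qed.

Lemma ip0l f : car f -> ip 0 f = 0.
Proof.
move=> cf; have := rk_inner_linear 1 (rk_zero H) (rk_zero H) cf.
rewrite scaler0 addr0 mul1r => /eqP.
by rewrite -subr_eq0 opprD addrA subrr sub0r oppr_eq0 => /eqP.
Qed.

Lemma hnorm2_ge0 f : car f -> 0 <= hnorm2 f.
Proof.
move=> cf; have [->|/eqP f0] := eqVneq f 0.
  by rewrite /hnorm2 ip0l//; exact: rk_zero.
have := rk_inner_pos cf f0; rewrite ip_self// ltcR; exact: ltW.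
Qed.

(** Cauchy-Schwarz, the parallelogram law and the variational equation of
    [positive_multiplier] are all read off from this expansion. *)
Lemma hnorm2D c f g : car f -> car g ->
  hnorm2 (f + c *: g) = hnorm2 f + 2 * Re (c^* * ip f g) + sqmod c * hnorm2 g.
Proof.
move=> cf cg; have ccg := rkhs_scale c cg; rewrite {1}/hnorm2.
rewrite ip_linear_l//; last exact: rkhs_add.
rewrite !ip_linear_r// !ip_self// (ip_conj cf cg).
move: (ip f g) (hnorm2 f) (hnorm2 g) => w p q.
by case: w => a b; case: c {ccg} => s t; rewrite /sqmod/=; ring.
Qed.

(** The squared norm of f - t <f, g> g is a nonnegative quadratic polynomial in the
    real number t. *)
Lemma cauchy_schwarz f g : car f -> car g -> sqmod (ip f g) <= hnorm2 f * hnorm2 g.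
Proof.
move=> cf cg; set q := sqmod _.
have h (t : R) : 0 <= hnorm2 f - 2 * t * q + t ^+ 2 * q * hnorm2 g.
  have := hnorm2_ge0 (rkhs_add cf (rkhs_scale (- (t%:C * ip f g)) cg)).
  rewrite hnorm2D//; congr (0 <= _); congr (_ + _ + _).
    rewrite rmorphN rmorphM/= /q; case: (ip f g) => a b; rewrite /sqmod/=; ring.
  rewrite /q; case: (ip f g) => a b; rewrite /sqmod/=; ring.
have [g0|g0] := eqVneq (hnorm2 g) 0; last first.
  have gp : 0 < hnorm2 g by rewrite lt_def g0 hnorm2_ge0.
  rewrite -ler_pdivrMr// -subr_ge0; have := h (hnorm2 g)^-1.
  by congr (0 <= _); field.
rewrite g0 mulr0; have [->//|q0] := eqVneq q 0.
have := h ((hnorm2 f + 1) / (2 * q)).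
rewrite g0 mulr0 addr0.
have -> : 2 * ((hnorm2 f + 1) / (2 * q)) * q = hnorm2 f + 1 by field.
lra.
Qed.

(** Indexing by lists turns sums and multiples of combinations of kernel
    functions into concatenations and maps. *)
Definition kcomb (s : seq (R[i] * X)) : X -> R[i] :=
  \sum_(p <- s) p.1 *: (fun z => K z p.2).

Lemma kcomb_car s : car (kcomb s).
Proof.
elim: s => [|p s IH]; rewrite /kcomb ?big_nil ?big_cons; first exact: rk_zero.
by apply: rk_linear => //; exact: rk_kernel.
Qed.

Lemma ip_kcomb f s : car f -> ip f (kcomb s) = \sum_(p <- s) (p.1)^* * f p.2.
Proof.
move=> cf; elim: s => [|p s IH].
  by rewrite /kcomb !big_nil (ip_conj (rk_zero H) cf) ip0l// rmorph0.
rewrite /kcomb !big_cons -/(kcomb s) addrC ip_linear_r ?IH//.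
- by rewrite addrC -rk_reproducing.
- exact: rk_kernel.
- exact: kcomb_car.
Qed.

Lemma kcombE s z : kcomb s z = \sum_(p <- s) p.1 * K z p.2.
Proof.
by elim: s => [|p s IH]; rewrite /kcomb ?big_nil// !big_cons -IH.
Qed.

Lemma kcomb_norm2 s :
  ip (kcomb s) (kcomb s) = \sum_(p <- s) \sum_(q <- s) (p.1)^* * K p.2 q.2 * q.1.
Proof.
rewrite (ip_kcomb s (kcomb_car s)); apply: eq_bigr => p _.
by rewrite kcombE mulr_sumr; apply: eq_bigr => q _; rewrite mulrCA mulrC.
Qed.

(** The inner product of f with sum_i a_i K(., x_i) is the sum on the left. *)
Lemma kernel_test f (I : finType) (x : I -> X) (a : I -> R[i]) : car f ->
  (sqmod (\sum_i (a i)^* * f (x i)))%:C <=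
  (hnorm2 f)%:C * \sum_i \sum_j (a i)^* * K (x i) (x j) * a j.
Proof.
move=> cf; pose s := [seq (a i, x i) | i <- enum I].
have -> : \sum_i \sum_j (a i)^* * K (x i) (x j) * a j = ip (kcomb s) (kcomb s).
  rewrite kcomb_norm2 big_map big_enum/=; apply: eq_bigr => i _.
  by rewrite big_map big_enum.
have -> : \sum_i (a i)^* * f (x i) = ip f (kcomb s).
  by rewrite ip_kcomb// big_map big_enum.
rewrite ip_self; last exact: kcomb_car.
by rewrite -rmorphM/= lecR; apply: cauchy_schwarz => //; exact: kcomb_car.
Qed.

End Rkhs.

(** * Multipliers from positivity *)

Section Multiplier.
Variables (R : realType) (X : Type) (K : X -> X -> R[i]) (H : rkhs K).
Variables (phi f : X -> R[i]) (A : R).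
Local Notation Re := complex.Re.
Local Notation car := (rk_carrier H).
Local Notation N := (hnorm2 H).
Local Notation comb := (@kcomb R X K).
Hypothesis A_ge0 : 0 <= A.
Hypothesis dom : positive_kernel (fun z w => A%:C * K z w - phi z * K z w * (phi w)^*).
Hypothesis cf : car f.

Implicit Types (s t : seq (R[i] * X)).

(** What <phi f, kcomb s> has to be, if phi f belongs to the space. *)
Let Lam s : R[i] := \sum_(p <- s) (p.1)^* * (phi p.2 * f p.2).
Let J s : R := N (comb s) - 2 * Re (Lam s).

Let twist s := [seq ((phi p.2)^* * p.1, p.2) | p <- s].

Let Lam_twist s : Lam s = rk_inner H f (comb (twist s)).
Proof.
rewrite ip_kcomb// big_map; apply: eq_bigr => p _ /=.
by rewrite rmorphM/= conjCK; ring.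
Qed.

Let twist_le s : N (comb (twist s)) <= A * N (comb s).
Proof.
have /npoint_positiveP := @dom (size s).
move=> /(_ (fun i => (tnth (in_tuple s) i).2) (fun i => (tnth (in_tuple s) i).1)).
rewrite /kernel_form => h.
rewrite -lecR rmorphM/= -!ip_self; try exact: kcomb_car.
rewrite -subr_ge0; move: h; congr (0 <= _).
rewrite !kcomb_norm2 big_map mulr_sumr -sumrB [RHS]big_tnth; apply: eq_bigr => i _.
rewrite big_map mulr_sumr -sumrB [RHS]big_tnth; apply: eq_bigr => j _ /=.
by rewrite rmorphM/= conjCK; ring.
Qed.

Let Lam_bound s : Re (Lam s) ^+ 2 <= (A * N f) * N (comb s).
Proof.
apply: (@le_trans _ _ (sqmod (Lam s))); first by rewrite /sqmod lerDl sqr_ge0.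
rewrite Lam_twist; apply: le_trans (cauchy_schwarz cf (kcomb_car H _)) _.
by rewrite [A * _]mulrC -mulrA ler_wpM2l ?twist_le// hnorm2_ge0.
Qed.

Let J_bound s : - (A * N f) <= J s.
Proof.
have n0 := hnorm2_ge0 (kcomb_car H s).
have f0 := hnorm2_ge0 cf.
have B0 : 0 <= A * N f by rewrite mulr_ge0.
have := Lam_bound s; rewrite /J.
move: (Re (Lam s)) (A * N f) (N (comb s)) n0 B0 => r B n n0 B0 h.
rewrite -subr_ge0 opprK.
rewrite leNgt; apply/negP => neg.
have h1 : 0 <= n + B < 2 * r by rewrite addr_ge0//=; lra.
have : (n + B) ^+ 2 < (2 * r) ^+ 2.
  by case/andP: h1 => h1 h2; rewrite ltrXn2r// ?nnegrE//; lra.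
have := sqr_ge0 (n - B); rewrite sqrrB sqrrD exprMn; lra.
Qed.

Let m : R := inf [set J s | s in setT].

Let has_m : has_inf [set J s | s in setT].
Proof.
split; first by exists (J [::]), [::].
by exists (- (A * N f)) => _ [s _ <-]; exact: J_bound.
Qed.

Let m_le s : m <= J s.
Proof. by apply: ge_inf; [case: has_m|exists s]. Qed.

Let comb_cat s t : comb (s ++ t) = comb s + comb t.
Proof. by rewrite /kcomb big_cat. Qed.

Let Lam_cat s t : Lam (s ++ t) = Lam s + Lam t.
Proof. by rewrite /Lam big_cat. Qed.

Let scale (c : R[i]) s := [seq (c * p.1, p.2) | p <- s].

Let comb_scale c s : comb (scale c s) = c *: comb s.
Proof.
rewrite /kcomb big_map scaler_sumr; apply: eq_bigr => p _.
by rewrite scalerA.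
Qed.

Let Lam_scale c s : Lam (scale c s) = c^* * Lam s.
Proof.
rewrite /Lam big_map mulr_sumr; apply: eq_bigr => p _ /=.
by rewrite rmorphM/= !mulrA.
Qed.

Let parallelogram s t : N (comb s - comb t) =
  2 * J s + 2 * J t - 4 * J (scale (2^-1)%:C (s ++ t)).
Proof.
have cs := kcomb_car H s; have ct := kcomb_car H t.
rewrite /J comb_scale Lam_scale comb_cat Lam_cat.
have c0 : car 0 by exact: rk_zero.
have c1 : car (comb s + 1 *: comb t) by apply: rkhs_add => //; exact: rkhs_scale.
have -> : comb s - comb t = comb s + (-1) *: comb t by rewrite scaleN1r.
have -> : (2^-1)%:C *: (comb s + comb t) = 0 + (2^-1)%:C *: (comb s + 1 *: comb t).
  by rewrite add0r scale1r.
rewrite (hnorm2D _ c0 c1) !(hnorm2D _ cs ct) ip0l//.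
have -> : N 0 = 0 by rewrite /hnorm2 ip0l.
case: (rk_inner H (comb s) (comb t)) => a b.
case: (Lam s) => p q; case: (Lam t) => p' q'.
rewrite /sqmod/= !oppr0; by field.
Qed.

Let minimizing : exists s : nat -> seq (R[i] * X), forall n, J (s n) < m + n.+1%:R^-1.
Proof.
suff /choice [s hs] : forall n : nat, exists s, J s < m + n.+1%:R^-1 by exists s.
move=> n; have n0 : 0 < n.+1%:R^-1 :> R by rewrite invr_gt0.
have [_ [s _ <-] hs] := inf_adherent n0 has_m.
by exists s.
Qed.

(** Riesz representation. By positivity, [Lam] is bounded with respect to the
    norm of the combination, so J is bounded below. By the parallelogram law a
    minimizing sequence for J is Cauchy; its limit F satisfies the variational
    equation <F, kcomb s> = Lam s, which for a single kernel function reads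
    F x = phi x f x. *)
Lemma positive_multiplier : car (phi \* f).
Proof.
have [s hs] := minimizing.
have small (n : nat) : 0 <= n.+1%:R^-1 :> R by rewrite invr_ge0.
have cs n := kcomb_car H (s n).
have ccs n n' : car (comb (s n) - comb (s n')) by exact: rkhs_sub.
have diff n n' : N (comb (s n) - comb (s n')) <= 2 * n.+1%:R^-1 + 2 * n'.+1%:R^-1.
  rewrite parallelogram.
  move: (m_le (scale (2^-1)%:C (s n ++ s n'))) (hs n) (hs n').
  move: (J _) (J (s n)) (J (s n')) n.+1%:R^-1 n'.+1%:R^-1 => j1 j2 j3 e1 e2.
  by generalize m => m0 *; lra.
have archi (e : R) : 0 < e -> exists M : nat, forall n, (M <= n)%N -> n.+1%:R^-1 < e.
  move=> e0; exists (Num.truncn e^-1) => n Mn.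
  rewrite invf_plt ?posrE//; apply: lt_le_trans (truncnS_gt _) _.
  by rewrite ler_nat.
have [|F cF hF] := @rk_complete _ _ _ H (fun n => comb (s n)) cs.
  move=> e e0; have e4 : 0 < e ^+ 2 / 4 by rewrite divr_gt0// exprn_gt0.
  have [M hM] := archi _ e4.
  exists M => p q Mp Mq; rewrite -/(N _).
  rewrite -[ltRHS](ger0_norm (ltW e0)) -sqrtr_sqr ltr_sqrt ?exprn_gt0//.
  apply: le_lt_trans (diff p q) _; move: (hM p Mp) (hM q Mq).
  by move: p.+1%:R^-1 q.+1%:R^-1 (e ^+ 2) => *; lra.
suff -> : phi \* f = F by [].
apply/funext => x; apply/esym/eqP; rewrite -subr_eq0; apply/eqP; apply: sqmod_eq0.
apply/eqP; rewrite eq_le sqmod_ge0 andbT.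
pose k : X -> R[i] := fun z => K z x.
have ck : car k := rk_kernel H x.
pose kap := N k; have kap0 : 0 <= kap := hnorm2_ge0 ck.
pose del n := comb (s n) x - phi x * f x.
have delb n : sqmod (del n) <= (kap + 1) * n.+1%:R^-1.
  pose sg : R := (kap + 1)^-1.
  (* moving comb (s n) by c k cannot bring J below its infimum m; this is nearly
     the optimal c, the 1 in sg avoiding a division by 0 when kap = 0 *)
  pose c := - (sg%:C * del n).
  have := m_le (s n ++ [:: (c, x)]); rewrite /J comb_cat Lam_cat.
  have -> : comb [:: (c, x)] = c *: k by rewrite /kcomb big_seq1.
  have -> : Lam [:: (c, x)] = c^* * (phi x * f x) by rewrite /Lam big_seq1.
  rewrite hnorm2D// -(rk_reproducing x (cs n)) -/kap.
  have := hs n; rewrite /J.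
  have e1 : Re (c^* * comb (s n) x) - Re (c^* * (phi x * f x)) = - sg * sqmod (del n).
    rewrite /c /del; case: (comb (s n) x) => a b; case: (phi x * f x) => a' b'.
    rewrite /sqmod/=; ring.
  have e2 : sqmod c = sg ^+ 2 * sqmod (del n).
    by rewrite /c; case: (del n) => a b; rewrite /sqmod/=; ring.
  rewrite e2.
  have ReD (z w : R[i]) : Re (z + w) = Re z + Re w by case: z; case: w.
  rewrite ReD => h1 h2.
  have k1 : kap + 1 != 0 by rewrite lt0r_neq0// ltr_wpDl.
  have sg0 : 0 < sg by rewrite invr_gt0 ltr_wpDl.
  have b0 : 0 <= sg ^+ 2 * sqmod (del n) by rewrite mulr_ge0 ?sqr_ge0 ?sqmod_ge0.
  have e3 : sg ^+ 2 * sqmod (del n) * kap = sg * sqmod (del n) - sg ^+ 2 * sqmod (del n).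
    by rewrite /sg; field.
  have h3 : sg * sqmod (del n) <= n.+1%:R^-1.
    move: h1 h2 e1 b0; rewrite e3 mulNr.
    move: (sg * sqmod (del n)) (sg ^+ 2 * sqmod (del n)) n.+1%:R^-1 (N _) (Re _) => a b v p r1.
    move: (Re _) (Re _) => r2 r3; generalize m => m0 *; lra.
  have -> : sqmod (del n) = (kap + 1) * (sg * sqmod (del n)) by rewrite /sg; field.
  by rewrite ler_wpM2l// addr_ge0.
apply/ler_addgt0Pr => e e0; rewrite add0r.
pose e' := e / (4 * (kap + 1)).
have k1 : 0 < kap + 1 by rewrite ltr_wpDl.
have e'0 : 0 < e' by rewrite divr_gt0// mulr_gt0.
have [M1 hM1] := archi _ e'0.
have se : 0 < Num.sqrt e' by rewrite sqrtr_gt0.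
have [M2 hM2] := hF _ se.
pose n := maxn M1 M2.
have d1 : sqmod (del n) <= e / 4.
  apply: le_trans (delb n) _.
  have -> : e / 4 = (kap + 1) * e' by rewrite /e'; field; rewrite lt0r_neq0.
  by rewrite ler_wpM2l ?(ltW k1)// ltW// hM1// leq_maxl.
have cFs : car (comb (s n) - F) by exact: rkhs_sub.
have d2 : sqmod (F x - comb (s n) x) <= e / 4.
  have -> : sqmod (F x - comb (s n) x) = sqmod (rk_inner H (comb (s n) - F) k).
    rewrite -(rk_reproducing x cFs) -opprB.
    have -> : (comb (s n) - F) x = comb (s n) x - F x by [].
    by case: (comb (s n) x - F x) => a b; rewrite /sqmod/= !sqrrN.
  apply: le_trans (cauchy_schwarz cFs ck) _.
  have := hM2 n (leq_maxr _ _); rewrite -/(N _) ltr_sqrt// => lt.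
  have -> : e / 4 = e' * (kap + 1) by rewrite /e'; field; rewrite lt0r_neq0.
  apply: ler_pM; rewrite ?hnorm2_ge0//; first exact: ltW.
  by rewrite -/kap lerDl.
have -> : F x - (phi \* f) x = (F x - comb (s n) x) + del n.
  by rewrite /del addrA subrK.
by apply: le_trans (sqmodD_le _ _) _; lra.
Qed.

End Multiplier.

(** * Coefficients from the torus *)

Section Roots.
Variable F : numClosedFieldType.

Lemma prim_root_exists n : (0 < n)%N -> exists z : F, n.-primitive_root z.
Proof.
move=> n0; have [r] := closed_field_poly_normal ('X^n - 1 : {poly F}).
rewrite (monicP (monicXnsubC 1 n0)) scale1r => rE.
have [ur uq sz] : [/\ all n.-unity_root r, uniq r & (n <= size r)%N].
  split.
  - by apply/allP => z zr; rewrite /root_of_unity rE root_prod_XsubC.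
  - rewrite -separable.separable_prod_XsubC -rE.
    by rewrite cyclotomic.separable_Xn_sub_1// pnatr_eq0 -lt0n.
  - by rewrite -ltnS -(size_prod_XsubC r id) -rE size_XnsubC.
by have /hasP[z _ zP] := cyclic.has_prim_root n0 ur uq sz; exists z.
Qed.

Lemma prim_root_norm n (z : F) : n.-primitive_root z -> `|z| = 1.
Proof.
move=> zP; have n0 := prim_order_gt0 zP.
by apply/eqP; rewrite -(pexpr_eq1 n0)// -normrX (prim_expr_order zP) normr1.
Qed.

Lemma prim_root_orth n (z : F) p q : n.-primitive_root z -> (p < n)%N -> (q < n)%N ->
  \sum_(t < n) (z ^+ p) ^+ t * ((z ^+ q) ^+ t)^* = if p == q then n%:R else 0.
Proof.
move=> zP pn qn; have z1 := prim_root_norm zP.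
have n0 := prim_order_gt0 zP.
have zz k : z ^+ k * (z ^+ k)^* = 1 by rewrite -normCK normrX z1 !expr1n.
pose w := z ^+ p * (z ^+ q)^*.
rewrite (eq_bigr (fun t : 'I_n => w ^+ t)); last first.
  by move=> t _; rewrite /w exprMn rmorphXn.
have [pq|pq] := eqVneq p q.
  rewrite (eq_bigr (fun=> 1)); last by move=> t _; rewrite /w pq zz expr1n.
  by rewrite sumr_const card_ord.
have w1 : w != 1.
  apply: contra pq => /eqP w1.
  have : z ^+ p == z ^+ q.
    have -> : z ^+ p = w * z ^+ q by rewrite /w -mulrA [_^* * _]mulrC zz mulr1.
    by rewrite w1 mul1r.
  by rewrite (eq_prim_root_expr zP) !modn_small.
have wn : w ^+ n = 1.
  rewrite /w exprMn -rmorphXn -!exprM ![(_ * n)%N]mulnC !exprM.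
  by rewrite (prim_expr_order zP) !expr1n rmorph1 mulr1.
have := subrX1 w n; rewrite wn subrr => /esym/eqP.
by rewrite mulf_eq0 subr_eq0 (negbTE w1) => /eqP.
Qed.

End Roots.

Section Torus.
Variables (R : realType) (d m : nat) (rho : R) (zeta : R[i]) (N : nat).
Hypothesis d_gt0 : (0 < d)%N.
Hypothesis rho01 : 0 < rho < 1.
Hypothesis zetaP : m.-primitive_root zeta.
Hypothesis Nm : (N < m)%N.

Definition ball_coord (i : 'I_d) (z : unit_ball R d) : R[i] := val z 0 i.
Local Notation Z := ball_coord.

Let z1 : `|zeta| = 1 := prim_root_norm zetaP.
Let r0 : R := rho / Num.sqrt d%:R.

Let r0_sqr : r0 ^+ 2 = rho ^+ 2 / d%:R.
Proof. by rewrite /r0 expr_div_n sqr_sqrtr. Qed.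

Let nC0 (x : R) : 0 <= x -> `|x%:C| = x%:C :> R[i].
Proof. by move=> x0; rewrite ger0_norm// ler0c. Qed.

Let r0_ge0 : 0 <= r0.
Proof. by case/andP: rho01 => p _; rewrite divr_ge0 ?sqrtr_ge0// ltW. Qed.

Let sum_const_div (x : R) : \sum_(i < d) (x / d%:R)%:C = x%:C :> R[i].
Proof.
rewrite -rmorph_sum/= sumr_const card_ord -[_ *+ d]mulr_natr divfK//.
by rewrite pnatr_eq0 -lt0n.
Qed.

Let torus_in (th : {ffun 'I_d -> 'I_m}) :
  \sum_(i < d) `|(\row_i (r0%:C * zeta ^+ th i)) 0 i| ^+ 2 < 1.
Proof.
rewrite (eq_bigr (fun=> (rho ^+ 2 / d%:R)%:C)); last first.
  move=> i _; rewrite mxE normrM (nC0 r0_ge0) normrX z1 expr1n mulr1.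
  by rewrite -rmorphXn/= r0_sqr.
rewrite sum_const_div ltcR.
by case/andP: rho01 => p q; rewrite expr_lt1// ltW.
Qed.

Definition torus_pt th : unit_ball R d := 
  exist (fun z : 'rV[R[i]]_d => is_true (\sum_(i < d) `|z 0 i| ^+ 2 < 1)) _ (torus_in th).

Let conjC (x : R) : (x%:C)^* = x%:C :> R[i].
Proof. exact: conjc_real. Qed.

Let conjM (x y : R[i]) : (x * y)^* = x^* * y^*.
Proof. exact: rmorphM. Qed.

Lemma coord_dot_torus th th' : coord_dot Z (torus_pt th) (torus_pt th') =
  \sum_i (rho ^+ 2 / d%:R)%:C * (zeta ^+ th i * (zeta ^+ th' i)^*).
Proof.
apply: eq_bigr => i _; rewrite /Z /= !mxE conjM conjC.
by rewrite mulrACA -rmorphM/= -expr2 r0_sqr.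
Qed.

Lemma coord_dot_torus_norm th th' :
  `|coord_dot Z (torus_pt th) (torus_pt th')| <= (rho ^+ 2)%:C.
Proof.
rewrite coord_dot_torus; apply: le_trans (ler_norm_sum _ _ _) _.
rewrite (eq_bigr (fun=> (rho ^+ 2 / d%:R)%:C)); last first.
  move=> i _; rewrite normrM nC0; last by rewrite divr_ge0// sqr_ge0.
  by rewrite normrM norm_conjC !normrX z1 !expr1n !mulr1.
by rewrite sum_const_div.
Qed.

Lemma coord_dot_torus_diag th :
  coord_dot Z (torus_pt th) (torus_pt th) = (rho ^+ 2)%:C.
Proof.
rewrite coord_dot_torus (eq_bigr (fun=> (rho ^+ 2 / d%:R)%:C)); last first.
  by move=> i _; rewrite -normCK normrX z1 !expr1n mulr1.
by rewrite sum_const_div.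
Qed.

Lemma diag_monomial_torus th : diag_monomial Z (torus_pt th) = (rho ^+ d)%:C * \prod_i zeta ^+ th i.
Proof.
rewrite /diag_monomial (eq_bigr (fun i => rho%:C * zeta ^+ th i)); last first.
  move=> i _; rewrite /Z /= mxE mulrA -rmorphM/=; congr (_%:C * _).
  by rewrite /r0 mulrC divfK// sqrtr_eq0 -ltNge ltr0n.
by rewrite big_split/= prodr_const card_ord rmorphXn.
Qed.

(** Averaging against this character keeps, of all monomials of degree less
    than m in each variable, the one with all exponents equal to N. *)
Definition torus_char (th : {ffun 'I_d -> 'I_m}) : R[i] := \prod_i (zeta ^+ N) ^+ th i.

Lemma torus_char_norm th : `|torus_char th| = 1.
Proof.
rewrite /torus_char normr_prod big1// => i _.
by rewrite !normrX z1 !expr1n.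
Qed.

(** The contribution of <z, w>^k to the squared norm of
    sum_th torus_char th K(., torus_pt th). *)
Definition torus_moment k : R[i] := \sum_th \sum_th'
  (torus_char th)^* * coord_dot Z (torus_pt th) (torus_pt th') ^+ k * torus_char th'.

Lemma torus_pairing : \sum_th (torus_char th)^* * diag_monomial Z (torus_pt th) ^+ N =
  (m%:R ^+ d * rho ^+ (d * N))%:C.
Proof.
rewrite (eq_bigr (fun=> (rho ^+ (d * N))%:C)); last first.
  move=> th _; rewrite diag_monomial_torus exprMn -rmorphXn/= -exprM mulrCA.
  have -> : (\prod_i zeta ^+ th i) ^+ N = torus_char th.
    by rewrite -prodrXl; apply: eq_bigr => i _; rewrite -!exprM mulnC.
  by rewrite [_ * torus_char th]mulrC -normCK torus_char_norm expr1n mulr1.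
by rewrite -rmorph_sum/= sumr_const card_ffun !card_ord -[_ *+ _]mulr_natl natrX.
Qed.

Lemma torus_moment_ge0 k : 0 <= torus_moment k.
Proof.
have := @coord_dot_exp_positive R _ d Z k #|{ffun 'I_d -> 'I_m}|.
move=> /npoint_positiveP /(_ (fun i => torus_pt (enum_val i)) (fun i => torus_char (enum_val i))).
have eS (F : {ffun 'I_d -> 'I_m} -> R[i]) :
    \sum_(i < #|{ffun 'I_d -> 'I_m}|) F (enum_val i) = \sum_th F th.
  by rewrite -(big_enum_val F).
pose G th th' := (torus_char th)^* * coord_dot Z (torus_pt th) (torus_pt th') ^+ k * torus_char th'.
rewrite /kernel_form (eS (fun th => \sum_j G th (enum_val j))); congr (0 <= _).
by apply: eq_bigr => th _; rewrite (eS (G th)).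
Qed.

Lemma torus_moment_le k : torus_moment k <= (m%:R ^+ (2 * d) * (rho ^+ 2) ^+ k)%:C.
Proof.
rewrite -[torus_moment k]ger0_norm ?torus_moment_ge0//.
have -> : (m%:R ^+ (2 * d) * (rho ^+ 2) ^+ k)%:C =
  \sum_(th : {ffun 'I_d -> 'I_m}) \sum_(th' : {ffun 'I_d -> 'I_m}) ((rho ^+ 2) ^+ k)%:C :> R[i].
  under eq_bigr do rewrite -rmorph_sum/=.
  rewrite -rmorph_sum/= !sumr_const card_ffun !card_ord -mulrnA -(mulr_natl (_ ^+ k)).
  by rewrite natrM natrX mul2n -addnn exprD.
apply: le_trans (ler_norm_sum _ _ _) _; apply: ler_sum => th _.
apply: le_trans (ler_norm_sum _ _ _) _; apply: ler_sum => th' _.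
rewrite !normrM norm_conjC !torus_char_norm mul1r mulr1 normrX rmorphXn/=.
by rewrite lerXn2r ?nnegrE// ?coord_dot_torus_norm// ler0c sqr_ge0.
Qed.

(** Expanding by the multinomial theorem, the index al contributes the squared
    modulus of a product of sums of roots of unity, which vanishes unless all
    al_i are equal to N. *)
Lemma torus_momentE k : (k < m)%N ->
  torus_moment k = if k == (d * N)%N then
    ((k`!)%:R * ((rho ^+ 2 / d%:R) ^+ k / N`!%:R ^+ d * m%:R ^+ (2 * d)))%:C else 0.
Proof.
move=> km; pose s : R[i] := (rho ^+ 2 / d%:R)%:C.
pose e p : R[i] := \sum_(t < m) (zeta ^+ p) ^+ t * ((zeta ^+ N) ^+ t)^*.
have fk : k`!%:R != 0 :> R[i] by rewrite pnatr_eq0 -lt0n fact_gt0.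
have -> : torus_moment k = k`!%:R *
   \sum_(al : {ffun 'I_d -> 'I_k.+1} | (\sum_i al i)%N == k)
     (\prod_i (s ^+ al i / (al i)`!%:R)) * (\prod_i e (al i) * (\prod_i e (al i))^*).
  rewrite /torus_moment.
  transitivity (\sum_(th : {ffun 'I_d -> 'I_m}) \sum_(th' : {ffun 'I_d -> 'I_m}) k`!%:R *
   \sum_(al : {ffun 'I_d -> 'I_k.+1} | (\sum_i al i)%N == k)
     (\prod_i (s ^+ al i / (al i)`!%:R)) *
     (\prod_i ((zeta ^+ al i) ^+ th i * ((zeta ^+ N) ^+ th i)^*) *
      (\prod_i ((zeta ^+ al i) ^+ th' i * ((zeta ^+ N) ^+ th' i)^*))^*)).
    apply: eq_bigr => th _; apply: eq_bigr => th' _.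
    rewrite coord_dot_torus -[X in _ * X * _](@divfK _ k`!%:R)//.
    rewrite (@multinomial_exp _ k.+1)//.
    set S := (X in _ * (X * _) * _).
    have -> : (torus_char th)^* * (S * k`!%:R) * torus_char th' =
       k`!%:R * ((torus_char th)^* * torus_char th' * S) by ring.
    rewrite /S mulr_sumr; congr (_ * _); apply: eq_bigr => al _.
    rewrite /torus_char !rmorph_prod -!big_split/=; apply: eq_bigr => i _.
    rewrite -/s !exprMn rmorphM/= conjCK !rmorphXn/= -!exprM ![(al i * _)%N]mulnC.
    by ring.
  rewrite mulr_sumr.
  under eq_bigr do (under eq_bigr do rewrite mulr_sumr).
  under eq_bigr do rewrite exchange_big/=.
  rewrite exchange_big/=; apply: eq_bigr => al _.
  have -> : \prod_i e (al i) = \sum_(th : {ffun 'I_d -> 'I_m})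
      \prod_i ((zeta ^+ al i) ^+ th i * ((zeta ^+ N) ^+ th i)^*).
    by rewrite bigA_distr_bigA.
  rewrite rmorph_sum mulr_suml !mulr_sumr; apply: eq_bigr => th _.
  by rewrite !mulr_sumr; apply: eq_bigr => th' _; rewrite !mulrA.
have eE (al : {ffun 'I_d -> 'I_k.+1}) i : e (al i) = if al i == N :> nat then m%:R else 0.
  by rewrite /e prim_root_orth// (leq_trans (ltn_ord _)).
have nz (al : {ffun 'I_d -> 'I_k.+1}) i : al i != N :> nat -> \prod_i e (al i) = 0.
  by move=> ai; rewrite (bigD1 i)//= eE (negbTE ai) mul0r.
case: eqP => [kE|kN]; last first.
  rewrite big1 ?mulr0// => al /eqP alk.
  have [/existsP[i ai]|/existsPn h] := boolP [exists i, al i != N :> nat].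
    by rewrite (nz _ i ai) mul0r mulr0.
  case: kN; rewrite -alk (eq_bigr (fun=> N)); last by move=> i _; apply/eqP/negPn/h.
  by rewrite sum_nat_const card_ord.
have Nk : (N < k.+1)%N by rewrite ltnS kE leq_pmull.
pose al0 : {ffun 'I_d -> 'I_k.+1} := [ffun=> Ordinal Nk].
have al0E i : al0 i = N :> nat by rewrite ffunE.
rewrite (bigD1 al0)/=; last first.
  by rewrite (eq_bigr (fun=> N))// sum_nat_const card_ord kE.
rewrite [X in _ + X]big1 ?addr0; last first.
  move=> al /andP[_ alN]; have [/existsP[i ai]|/existsPn h] := boolP [exists i, al i != N :> nat].
    by rewrite (nz _ i ai) mul0r mulr0.
  by case/eqP: alN; apply/ffunP => i; apply/val_inj; rewrite /= al0E; exact/eqP/negPn/h.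
have -> : \prod_i e (al0 i) = m%:R ^+ d.
  transitivity (\prod_(i < d) (m%:R : R[i])); last by rewrite prodr_const card_ord.
  by apply: eq_bigr => i _; rewrite eE al0E eqxx.
have -> : \prod_i (s ^+ al0 i / (al0 i)`!%:R) = (s ^+ N / N`!%:R) ^+ d.
  transitivity (\prod_(i < d) (s ^+ N / N`!%:R)); last by rewrite prodr_const card_ord.
  by apply: eq_bigr => i _; rewrite al0E.
rewrite rmorphXn/= rmorph_nat.
rewrite !rmorphM/= fmorphV/= !rmorphXn/= !rmorph_nat.
have -> : (s ^+ N / N`!%:R) ^+ d = s ^+ k / N`!%:R ^+ d.
  by rewrite expr_div_n -exprM mulnC -kE.
by rewrite mul2n -addnn exprD.
Qed.
End Torus.

(** * The norm of the diagonal monomials *)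

Section LowerBound.
Variables (R : realType) (d : nat) (c : R^nat).
Variables (K : unit_ball R d -> unit_ball R d -> R[i]) (H : rkhs K) (N : nat).
Hypothesis d_gt0 : (0 < d)%N.
Hypothesis c_gt0 : forall k, 0 < c k.
Hypothesis c0 : c 0%N = 1.
Local Notation Z := (@ball_coord R d).
Hypothesis Kseries : forall z w,
  ccvg (fun n => \sum_(k < n) (c k)%:C * coord_dot Z z w ^+ k) (K z w).
Hypothesis cf : rk_carrier H (fun z => diag_monomial Z z ^+ N).

Let fact_neq0R n : n`!%:R != 0 :> R. Proof. by rewrite pnatr_eq0 -lt0n fact_gt0. Qed.

Let hn := hnorm2 H (fun z => diag_monomial Z z ^+ N).
Let kap : R := c (d * N)%N * (d * N)`!%:R / (N`!%:R ^+ d * d%:R ^+ (d * N)).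

(** The product of the growth factors telescopes. *)
Lemma diag_norm2E : diag_norm2 d c N * kap = 1.
Proof.
have d0 : d%:R != 0 :> R by rewrite pnatr_eq0 -lt0n.
have den : N`!%:R ^+ d * d%:R ^+ (d * N) != 0 :> R.
  by rewrite mulf_neq0 ?expf_neq0.
rewrite /kap mulrA; apply: (canLR (mulfK den)); rewrite mul1r.
elim: (N) => [|n IH].
  by rewrite /diag_norm2 /growth_prod big_ord0 !muln0 c0 fact0 expr0 expr1n !mulr1.
rewrite diag_norm2S mulnS [(d + _)%N]addnC.
have h : growth d c (d * n) * (c (d * n + d)%N * (d * n + d)`!%:R) =
   (d * n + d)%:R ^+ d * (c (d * n)%N * (d * n)`!%:R).
  rewrite /growth divfK// mulf_neq0 ?fact_neq0R//; exact: lt0r_neq0.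
have e : (d * n + d)%:R = d%:R * n.+1%:R :> R by rewrite addnC -mulnS natrM.
by rewrite -mulrA h mulrCA IH e factS natrM !exprMn exprD; ring.
Qed.

Variable rho : R.
Hypothesis rho01 : 0 < rho < 1.

Let T (n : nat) : R := \sum_(k < n) c k * (rho ^+ 2) ^+ k.

Lemma torus_series_cvg : exists t : R, T @ \oo --> t.
Proof.
have [z zP] := @prim_root_exists R[i] 1 isT.
pose th : {ffun 'I_d -> 'I_1} := [ffun=> ord0].
pose x := torus_pt d_gt0 rho01 zP th.
exists (complex.Re (K x x)).
suff -> : T = (fun n => complex.Re (\sum_(k < n) (c k)%:C * coord_dot Z x x ^+ k)).
  exact: (Kseries x x).1.
apply/funext => n; rewrite (coord_dot_torus_diag d_gt0 rho01 zP th) /T.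
rewrite (eq_bigr (fun k : 'I_n => (c k * (rho ^+ 2) ^+ k)%:C)).
  by rewrite -rmorph_sum.
by move=> k _; rewrite -rmorphXn -rmorphM.
Qed.

Let T_mono n n' : (n <= n')%N -> T n <= T n'.
Proof.
move=> nn; rewrite /T (big_ord_widen_cond _ predT (fun k => c k * (rho ^+ 2) ^+ k) nn).
rewrite [leRHS](bigID (fun i : 'I_n' => (i < n)%N))/= lerDl sumr_ge0// => i _.
by apply: mulr_ge0; [exact: ltW|rewrite exprn_ge0// sqr_ge0].
Qed.

(** Below degree m only the moment of degree d N survives; the moments of
    higher degree add up to at most a tail of the convergent series T. *)
Lemma torus_bound m (t : R) : T @ \oo --> t -> (d * N < m)%N ->
  (rho ^+ 2) ^+ (d * N) <= hn * (kap * (rho ^+ 2) ^+ (d * N) + (t - T m)).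
Proof.
move=> Tt dNm.
have m0 : (0 < m)%N by rewrite (leq_ltn_trans _ dNm).
have Nm : (N < m)%N by rewrite (leq_ltn_trans _ dNm)// leq_pmull.
have [z zP] := @prim_root_exists R[i] m m0.
have T_le n : T n <= t.
  rewrite -(cvg_lim (@Rhausdorff R) Tt); apply: nondecreasing_cvgn_le.
    by move=> i j; exact: T_mono.
  by apply/cvg_ex; exists t.
pose x := torus_pt d_gt0 rho01 zP.
pose a (th : {ffun 'I_d -> 'I_m}) := torus_char z N th.
pose mom k := torus_moment N d_gt0 rho01 zP k.
pose Q := \sum_i \sum_j (a i)^* * K (x i) (x j) * a j.
have Qcvg : ccvg (fun n => \sum_(k < n) (c k)%:C * mom k) Q.
  have h : ccvg (fun n => \sum_i \sum_j ((a i)^* * a j) *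
     (\sum_(k < n) (c k)%:C * coord_dot Z (x i) (x j) ^+ k))
     (\sum_i \sum_j ((a i)^* * a j) * K (x i) (x j)).
    by apply: ccvg_sum => i; apply: ccvg_sum => j; apply: ccvgZ.
  have -> : Q = \sum_i \sum_j ((a i)^* * a j) * K (x i) (x j).
    by apply: eq_bigr => i _; apply: eq_bigr => j _; rewrite mulrAC.
  move: h; congr ccvg; apply/funext => n.
  under eq_bigr do (under eq_bigr do rewrite mulr_sumr).
  under eq_bigr do rewrite exchange_big/=.
  rewrite exchange_big/=; apply: eq_bigr => k _.
  rewrite /mom /torus_moment mulr_sumr; apply: eq_bigr => i _.
  by rewrite mulr_sumr; apply: eq_bigr => j _; rewrite /a /x; ring.
pose M : R := m%:R ^+ (2 * d).
have M0 : 0 < M by rewrite exprn_gt0// ltr0n.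
have Qle : Q <= (M * (kap * (rho ^+ 2) ^+ (d * N) + (t - T m)))%:C.
  rewrite -subr_ge0.
  have := ccvg_addn m Qcvg.
  move=> /(ccvgZ (- 1)) /(ccvgD (ccvg_cst
    (M * (kap * (rho ^+ 2) ^+ (d * N) + (t - T m)))%:C)).
  rewrite mulN1r; apply: ccvg_ge0 => n.
  rewrite mulN1r subr_ge0 big_split_ord/= mulrDr rmorphD/=; apply: lerD.
    rewrite (bigD1 (Ordinal dNm))//= big1 ?addr0.
      rewrite /mom torus_momentE// eqxx -rmorphM/= lecR le_eqVlt; apply/orP; left.
      apply/eqP; rewrite /kap /M expr_div_n; field.
      by rewrite !expf_neq0 ?fact_neq0R// pnatr_eq0 -lt0n.
    move=> i iN; rewrite /mom torus_momentE//.
    case: eqP => [e|_]; last by rewrite mulr0.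
    by case/eqP: iN; apply/val_inj.
  apply: (@le_trans _ _ (\sum_(i < n) (M * (c (m + i)%N * (rho ^+ 2) ^+ (m + i)))%:C)).
    apply: ler_sum => i _; rewrite mulrCA rmorphM/= ler_wpM2l ?ler0c ?(ltW (c_gt0 _))//.
    exact: torus_moment_le.
  rewrite -rmorph_sum/= lecR -mulr_sumr ler_wpM2l ?(ltW M0)//.
  have := T_le (m + n)%N; rewrite {1}/T big_split_ord/= -/(T m); lra.
have := @kernel_test R _ K H _ {ffun 'I_d -> 'I_m} x a cf.
rewrite -/Q torus_pairing// => h.
have : sqmod (m%:R ^+ d * rho ^+ (d * N))%:C <=
    hn * (M * (kap * (rho ^+ 2) ^+ (d * N) + (t - T m))).
  rewrite -lecR [leRHS]rmorphM; apply: le_trans h _.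
  by rewrite ler_wpM2l// ler0c hnorm2_ge0.
have -> : sqmod (m%:R ^+ d * rho ^+ (d * N))%:C = M * (rho ^+ 2) ^+ (d * N).
  by rewrite /sqmod/= expr0n addr0 exprMn /M -!exprM ![(_ * 2)%N]mulnC.
by rewrite [X in _ <= X -> _]mulrCA ler_pM2l.
Qed.

End LowerBound.

(** Letting m tend to infinity in [torus_bound] removes the tail. *)
Lemma diag_monomial_norm_ge (R : realType) (d : nat) (c : R^nat)
  (K : unit_ball R d -> unit_ball R d -> R[i]) (H : rkhs K) (N : nat) :
  (0 < d)%N -> (forall k, 0 < c k) -> c 0%N = 1 ->
  (forall z w, ccvg (fun n =>
    \sum_(k < n) (c k)%:C * coord_dot (@ball_coord R d) z w ^+ k) (K z w)) ->
  rk_carrier H (fun z => diag_monomial (@ball_coord R d) z ^+ N) ->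
  diag_norm2 d c N <= hnorm2 H (fun z => diag_monomial (@ball_coord R d) z ^+ N).
Proof.
move=> d0 cpos c0 Ks cf.
have r01 : 0 < (2^-1 : R) < 1 by apply/andP; split; lra.
have [t Tt] := torus_series_cvg d0 Ks r01.
set hn := hnorm2 H _.
have hn0 : 0 <= hn by exact: hnorm2_ge0.
set T := (fun n => _) in Tt.
pose p : R := (2^-1 ^+ 2) ^+ (d * N).
have p0 : 0 < p by rewrite !exprn_gt0.
set L := diag_norm2 d c N.
have := diag_norm2E N d0 cpos c0; rewrite -/L.
set kap := _ / _ => Lk.
suff : p <= hn * kap * p.
  rewrite -[X in X <= _]mul1r ler_pM2r// => h1.
  have L0 : 0 <= L by rewrite /L /diag_norm2 /growth_prod prodr_ge0// => i _; exact: growth_ge0.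
  have := ler_wpM2l L0 h1; rewrite mulr1 mulrCA Lk mulr1.
  exact.
apply/ler_addgt0Pr => e e0.
have e1 : 0 < e / (hn + 1) by rewrite divr_gt0// ltr_wpDl.
have [m0 _ hm] := (@cvgrPdist_lt _ _ _ _ _ _ _).1 Tt _ e1.
pose m := maxn m0 (d * N).+1.
have := torus_bound d0 cpos Ks cf r01 Tt (leq_maxr m0 (d * N).+1).
move=> /le_trans; apply; rewrite mulrDr mulrA lerD2l.
have := hm m (leq_maxl _ _) => /= /ltW /(le_trans (ler_norm _)) h.
apply: le_trans (ler_wpM2l hn0 h) _.
rewrite mulrCA ler_piMr ?(ltW e0)// ler_pdivrMr ?mul1r ?lerDl//.
by rewrite ltr_wpDl.
Qed.

(** * The kernels on the ball *)

Section DaKernel.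
Variables (R : realType) (d : nat).
Local Notation Z := (@ball_coord R d).
Implicit Types z w : unit_ball R d.

Lemma normE (x : R[i]) : `|x| = (Normc.normc x)%:C.
Proof. by []. Qed.

Lemma ball_norm z : \sum_i `|Z i z| ^+ 2 < 1.
Proof. by case: z. Qed.

Lemma coord_dot_lt1 z w : Normc.normc (coord_dot Z z w) < 1.
Proof.
rewrite -ltcR -normE; apply: le_lt_trans (ler_norm_sum _ _ _) _.
apply: (@le_lt_trans _ _ (2^-1 * (\sum_i `|Z i z| ^+ 2 + \sum_i `|Z i w| ^+ 2))).
  rewrite -big_split/= mulr_sumr; apply: ler_sum => i _.
  rewrite normrM norm_conjC -subr_ge0.
  have -> : 2^-1 * (`|Z i z| ^+ 2 + `|Z i w| ^+ 2) - `|Z i z| * `|Z i w| =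
     2^-1 * (`|Z i z| - `|Z i w|) ^+ 2 by field.
  by rewrite mulr_ge0 ?invr_ge0// real_exprn_even_ge0// rpredB// normr_real.
have h := ltrD (ball_norm z) (ball_norm w).
rewrite mulrC ltr_pdivrMr// mul1r.
by rewrite (_ : 2 = 1 + 1 :> R[i]).
Qed.

Lemma diag_monomial_norm_le1 z : (0 < d)%N -> `|diag_monomial Z z| <= 1.
Proof.
move=> d0.
rewrite -(@ler_pXn2r _ 2)// ?nnegrE// expr1n normCK -/(diag_kernel Z z z) diag_kernelE.
have := @leif_AGM_scaled R[i] 'I_d predT (fun i => `|Z i z| ^+ 2).
rewrite cardT size_enum_ord => /(_ _)[].
  by move=> i _; rewrite mulrn_wge0// exprn_ge0.
move=> h _.
have -> : d%:R ^+ d * \prod_i (Z i z * (Z i z)^*) = \prod_i (`|Z i z| ^+ 2 *+ d).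
  rewrite -[X in _ ^+ X]card_ord -prodr_const -big_split/=; apply: eq_bigr => i _.
  by rewrite normCK mulr_natl.
apply: le_trans h _; rewrite exprn_ile1//.
  by apply: sumr_ge0 => i _; rewrite exprn_ge0.
exact: ltW (ball_norm z).
Qed.

Lemma Da_kernel_series (a : R) z w : 0 <= a ->
  ccvg (fun n => \sum_(k < n) (Da_coef a k)%:C * coord_dot Z z w ^+ k) (Da_kernel d a z w).
Proof.
move=> a0; have u1 := coord_dot_lt1 z w.
rewrite /Da_kernel.
have -> : cdot (val z) (val w) = coord_dot Z z w by [].
case: ifPn => [/eqP aE|aN]; last first.
  apply: binomial_series => //.
  - by move=> k; apply: ltW; exact: Da_coef_gt0.
  - exact: Da_coef0.
  - by move=> k; exact: Da_coef_rec.
case: ifPn => [/eqP u0|u0].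
  have e : (fun n => \sum_(k < n.+1) (Da_coef a k)%:C * coord_dot Z z w ^+ k) = fun=> 1.
    apply/funext => n; rewrite big_ord_recl expr0 mulr1 Da_coef0 big1 ?addr0//.
    by move=> k _; rewrite u0 expr0n/= mulr0.
  by apply: ccvg_unshiftS; rewrite e; exact: ccvg_cst.
have := ccvgZ (coord_dot Z z w)^-1 (ccvg_shiftS (log_series u1)).
congr ccvg; apply/funext => n.
rewrite big_ord_recl/= invr0 mul0r add0r mulr_sumr; apply: eq_bigr => k _.
rewrite /Da_coef aE eqxx /bump/= exprS mulrCA; congr (_ * _).
by rewrite mulrA mulVf// mul1r.
Qed.

End DaKernel.

(** * Multiplier norm and n-point norm of the diagonal monomials *)

Section DiagNorms.
Variables (R : realType) (d : nat) (a : R) (H : rkhs (Da_kernel d a)).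
Hypothesis d_gt0 : (0 < d)%N.
Hypothesis a_ge0 : 0 <= a.
Hypothesis a_lt : a < d.+1%:R / 2.
Local Notation Z := (@ball_coord R d).
Local Notation K := (@Da_kernel R d a).
Local Notation c := (@Da_coef R a).
Local Notation r := (diag_monomial Z).
Local Notation lambda := (diag_norm2 d c).

Let c_gt0 k : 0 < c k. Proof. exact: Da_coef_gt0. Qed.
Let Kseries z w := @Da_kernel_series R d a z w a_ge0.
Let growth_dec m : growth d c m.+1 <= growth d c m.
Proof. by apply: Da_coef_growth_dec => //; exact: ltW. Qed.

Let lam_pos N : 0 < lambda N.
Proof.
have [s [b [s0 b0 h]]] := Da_coef_growth_ge d_gt0 a_ge0 a_lt.
exact: (diag_norm2_gt0 s0 b0 h).
Qed.

Lemma Da_kernel_positive : positive_kernel K.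
Proof. exact: (@kernel_positive R _ d Z c c_gt0 K Kseries). Qed.

Lemma Da_kernel_dominated M : positive_kernel (fun z w =>
  (domination_cst d c M)%:C * K z w - \sum_(j < M) diag_kernel Z z w ^+ j * K z w).
Proof.
have [s [b [s0 b0 h]]] := Da_coef_growth_ge d_gt0 a_ge0 a_lt.
by apply: kernel_dominated => // k; apply: (growth_prod_sum_le d_gt0 c_gt0 growth_dec s0 b0 h).
Qed.

Lemma diag_kernel_exp_positive j : positive_kernel (fun z w => diag_kernel Z z w ^+ j * K z w).
Proof.
apply: positive_ext (positive_conj (fun z => r z ^+ j) Da_kernel_positive) => z w.
by rewrite /diag_kernel exprMn rmorphXn/= mulrAC.
Qed.

Lemma domination_cst_ge0 M : 0 <= domination_cst d c M.
Proof.
rewrite /domination_cst mulr_ge0 ?(ltW (lam_pos _))// sumr_ge0// => i _.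
by rewrite invr_ge0 ltW.
Qed.

(** In the domination of r^0, ..., r^M, all powers but the last may be dropped,
    which leaves the hypothesis of [positive_multiplier]. *)
Lemma diag_monomial_exp_mult M : mult H (fun z => r z ^+ M).
Proof.
move=> f cf; apply: (@positive_multiplier R _ K H _ f (domination_cst d c M.+1)) => //.
  exact: domination_cst_ge0.
have h : positive_kernel (fun z w => \sum_(j < M) diag_kernel Z z w ^+ j * K z w).
  by apply: positive_sum => j _; exact: diag_kernel_exp_positive.
apply: positive_ext (positive_add (Da_kernel_dominated M.+1) h) => z w.
rewrite big_ord_recr/= /diag_kernel exprMn rmorphXn/= opprD addrA addrAC subrK.
by rewrite [in RHS]mulrAC.
Qed.

Let zero_in : \sum_(i < d) `|(0 : 'rV[R[i]]_d) 0 i| ^+ 2 < 1.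
Proof. by rewrite big1 ?ltr01// => i _; rewrite mxE normr0 expr0n. Qed.

Definition ball0 : unit_ball R d :=
  exist (fun z : 'rV[R[i]]_d => is_true (\sum_(i < d) `|z 0 i| ^+ 2 < 1)) _ zero_in.

(** At w = 0 only the constant term of the series is left. *)
Lemma Da_kernel_ball0 z : K z ball0 = 1.
Proof.
apply: (ccvg_unique (Kseries z ball0)); apply: ccvg_unshiftS.
have e : (fun n => \sum_(k < n.+1) (c k)%:C * coord_dot Z z ball0 ^+ k) = fun=> 1.
  apply/funext => n; rewrite big_ord_recl expr0 mulr1 Da_coef0 big1 ?addr0//.
  move=> k _; have -> : coord_dot Z z ball0 = 0.
    by rewrite /coord_dot big1// => i _; rewrite {2}/ball_coord /= mxE rmorph0 mulr0.
  by rewrite expr0n/= mulr0.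
by rewrite e; exact: ccvg_cst.
Qed.

Lemma one_in_rkhs : rk_carrier H (fun=> 1).
Proof.
by have := rk_kernel H ball0; congr rk_carrier; apply/funext => z; rewrite Da_kernel_ball0.
Qed.

Lemma rk_norm_one : rk_norm H (fun=> 1) = 1.
Proof.
have e : (fun=> 1) = K ^~ ball0 by apply/funext => z; rewrite Da_kernel_ball0.
rewrite /rk_norm {2}e -rk_reproducing; last exact: one_in_rkhs.
by rewrite sqrtr1.
Qed.

(** Test the multiplication operator on the constant function 1. *)
Lemma mult_norm_diag_ge M :
  ((Num.sqrt (lambda M))%:E <= mult_norm H (fun z => (r z ^+ M)%R))%E.
Proof.
have cr : rk_carrier H (fun z => r z ^+ M).
  have := diag_monomial_exp_mult M one_in_rkhs; congr rk_carrier.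
  by apply/funext => z /=; rewrite mulr1.
apply: (@le_trans _ _ (rk_norm H (fun z => r z ^+ M))%:E).
  rewrite lee_fin /rk_norm -/(hnorm2 H _) ler_sqrt.
    exact: diag_monomial_norm_ge (Da_coef0 a) Kseries cr.
  exact: hnorm2_ge0.
apply: ereal_sup_ubound; exists (fun=> 1).
  by split; [exact: one_in_rkhs|rewrite rk_norm_one].
by congr (rk_norm H _)%:E; apply/funext => z /=; rewrite mulr1.
Qed.

(** At the n given points r^(n L) agrees with psi = sum_k b_k r^k. The kernel
    D2 K - psi K psi^* is positive as the sum of three positive kernels: the
    convexity defect of psi, the defect of |b_k| <= 2^n / L, and the
    domination of the sum of the r^k K (r^k)^* by K. *)
Lemma npoint_norm_diag_le n L : (0 < L)%N ->
  (npoint_mult_norm K n (fun z => (r z ^+ (n * L))%R) <=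
   (Num.sqrt ((n * L)%:R * (2 ^+ n / L%:R) ^+ 2 * domination_cst d c (n * L))%R)%:E)%E.
Proof.
move=> L0; set M := (n * L)%N; pose B : R := 2 ^+ n / L%:R.
rewrite -/B; set D2 := _ * _ * _.
have D20 : 0 <= D2 by rewrite mulr_ge0 ?domination_cst_ge0// mulr_ge0// sqr_ge0.
apply: ereal_inf_lbound; exists (Num.sqrt D2) => //; split; first exact: sqrtr_ge0.
rewrite sqr_sqrtr// => x v.
have [b [bB bE]] := @interpolation_bounded R[i] n (fun i => r (x i)) L L0
   (fun i => diag_monomial_norm_le1 (x i) d_gt0).
have B0 : 0 <= B by rewrite divr_ge0// exprn_ge0.
have bB2 k : 0 <= (B ^+ 2)%:C - b k * (b k)^*.
  have BC0 : 0 <= B%:C :> R[i] by rewrite ler0c.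
  rewrite -normCK rmorphXn/= subr_ge0 lerXn2r ?nnegrE ?normr_ge0//.
  apply: le_trans (bB k) _; rewrite /B rmorphM/= fmorphV rmorphXn/= !rmorph_nat.
  by rewrite ler_wpM2r ?invr_ge0// lerBlDr lerDl.
pose g (k : 'I_M) z := b k * r z ^+ k.
have h1 := positive_convexity g Da_kernel_positive.
have h2 : positive_kernel (fun z w => M%:R * \sum_(k < M) ((B ^+ 2)%:C - b k * (b k)^*) *
   (diag_kernel Z z w ^+ k * K z w)).
  apply: positive_scale => //; apply: positive_sum => k _.
  by apply: positive_scale (diag_kernel_exp_positive k); exact: bB2.
have h3 : positive_kernel (fun z w => (M%:R * B ^+ 2)%:C *
    ((domination_cst d c M)%:C * K z w - \sum_(j < M) diag_kernel Z z w ^+ j * K z w)).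
  by apply: positive_scale (Da_kernel_dominated M); rewrite ler0c mulr_ge0 ?sqr_ge0.
have h : positive_kernel (fun z w => D2%:C * K z w -
    (\sum_i g i z) * K z w * (\sum_i g i w)^*).
  apply: positive_ext (positive_add (positive_add h1 h2) h3) => z w.
  have -> : \sum_(k < M) ((B ^+ 2)%:C - b k * (b k)^*) * (diag_kernel Z z w ^+ k * K z w) =
    (B ^+ 2)%:C * (\sum_(k < M) diag_kernel Z z w ^+ k * K z w) -
    \sum_i g i z * K z w * (g i w)^*.
    rewrite mulr_sumr -sumrB; apply: eq_bigr => k _; rewrite mulrBl; congr (_ - _).
    by rewrite /g /diag_kernel exprMn rmorphM/= rmorphXn/=; ring.
  rewrite /D2 !rmorphM/= rmorph_nat; ring.
have := (npoint_positiveP _ _).1 (@h n) x v; congr (0 <= _).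
apply: eq_bigr => i _; apply: eq_bigr => j _; rewrite mxE !bE /g; ring.
Qed.

End DiagNorms.

Theorem theorem1p3 (R : realType) (d : nat) (a : R)
    (H : rkhs (Da_kernel d a)) :
  (0 < d)%N -> 0 <= a -> a < d.+1%:R / 2 ->
  ~ exists (C : R) (n : nat), [/\ 0 < C, (0 < n)%N &
      forall phi : unit_ball R d -> R[i], mult H phi ->
        (mult_norm H phi <=
           C%:E * npoint_mult_norm (Da_kernel d a) n phi)%E].
Proof.
move=> d_gt0 a_ge0 a_lt [C [n [C0 n0 hC]]].
have [s [b [s0 b0 hs]]] := Da_coef_growth_ge d_gt0 a_ge0 a_lt.
have om0 N : 0 < diag_norm2 d (Da_coef a) N by exact: (diag_norm2_gt0 s0 b0 hs).
pose q : R := C ^+ 2 * n%:R ^+ 2 * (2 ^+ n) ^+ 2.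
have q0 : 0 < q.
  by apply: mulr_gt0; [apply: mulr_gt0|]; rewrite !exprn_gt0// ltr0n.
have e0 : 0 < (2 * q)^-1 by rewrite invr_gt0 mulr_gt0.
have [N hN] := diag_norm2V_mean d_gt0 s0 b0 hs e0.
pose L := N.+1; pose M := (n * L)%N.
have NM : (N <= M)%N by rewrite /M (leq_trans (leqnSn N))// leq_pmull.
have M0 : (0 < M)%N by rewrite muln_gt0 n0.
have := hN M NM; set S := \sum_(i < M) _ => hS.
have := hC _ (diag_monomial_exp_mult d_gt0 a_ge0 a_lt M).
move=> /(le_trans (mult_norm_diag_ge H d_gt0 a_ge0 a_lt M)).
have C0' : (0 <= C%:E)%E by rewrite lee_fin ltW.
move=> /le_trans /(_ (lee_wpmul2l C0'
  (npoint_norm_diag_le d_gt0 a_ge0 a_lt n (ltn0Sn N)))).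
rewrite -/L -/M -EFinM lee_fin => h.
have S0 : 0 <= S by rewrite sumr_ge0// => i _; rewrite invr_ge0 ltW.
have {}h : diag_norm2 d (Da_coef a) M <=
    C ^+ 2 * (M%:R * (2 ^+ n / L%:R) ^+ 2 * (diag_norm2 d (Da_coef a) M * S)).
  have := h; rewrite -(@ler_pXn2r _ 2)// ?nnegrE ?sqrtr_ge0//; last first.
    by rewrite mulr_ge0 ?sqrtr_ge0// ltW.
  rewrite exprMn !sqr_sqrtr ?(ltW (om0 _))//.
  by rewrite !mulr_ge0 ?sqr_ge0// ltW.
have : diag_norm2 d (Da_coef a) M * 1 <= diag_norm2 d (Da_coef a) M * (q / M%:R * S).
  rewrite mulr1; apply: le_trans h _; rewrite le_eqVlt; apply/orP; left; apply/eqP.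
  rewrite /q /M natrM; field.
  by rewrite !pnatr_eq0 -!lt0n n0.
rewrite ler_pM2l// => h1.
have : q / M%:R * S <= 2^-1.
  apply: (@le_trans _ _ (q / M%:R * ((2 * q)^-1 * M%:R))).
    by rewrite ler_wpM2l// divr_ge0// ltW.
  rewrite le_eqVlt; apply/orP; left; apply/eqP; field.
  by rewrite pnatr_eq0 -lt0n M0 lt0r_neq0.
lra.
Qed.
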